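(* Suppose $\mu=2$, $d=2k-1$ with $k\ge2$, and the parametrization $\phi$ induced by the data $\underline u(\underline T)$ is proper with a very singular point (placed at $(0:0:1)$ by a linear change of coordinates). Then the following $k+2=\frac{d+5}{2}$ polynomials form a minimal set of generators of $\mathcal K$: $$\{\mathcal E_d(\underline X),\,F_{2,1}(\underline T,\underline X),\,F_{2(k-1)-1,1}(\underline T,\underline X),\,\ldots,\,F_{1,k-1}(\underline T,\underline X),\,F_{1,k}(\underline T,\underline X)\},$$ where the dots run over $F_{2(k-j)-1,j}(\underline T,\underline X)$, $j=1,\ldots,k-1$, and all polynomials are as constructed in the context.
   Context: Let $\mathbb K$ be an algebraically closed field, $\underline T=(T_0,T_1)$, $\underline X=(X_0,X_1,X_2)$, and let $u_0,u_1,u_2\in\mathbb K[\underline T]$ be homogeneous of the same degree $d\ge1$ without common factors; $\underline u=(u_0,u_1,u_2)$, $I=\langle u_0,u_1,u_2\rangle\subset\mathbb K[\underline T]$. $\mathrm{Rees}(I)=\bigoplus_{n\ge0}I^nZ^n$ and $\mathcal K$ is the kernel of the $\mathbb K[\underline T]$-algebra epimorphism $\mathbb K[\underline T][\underline X]\to\mathrm{Rees}(I)$, $X_i\mapsto u_i(\underline T)Z$; it is a bihomogeneous ideal, and $\mathcal K_{i,j}$ is its component of bidegree $(i,j)$ ($i$ in $\underline T$, $j$ in $\underline X$). A double subscript $i,j$ on a polynomial in $\underline T,\underline X$ denotes its bidegree. $\mathcal K_{*,1}\cong\mathrm{Syz}(I)$ is a free $\mathbb K[\underline T]$-module of rank 2;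 fix a basis $P_{\mu,1},Q_{d-\mu,1}$ of bidegrees $(\mu,1),(d-\mu,1)$ with $0\le\mu\le d/2$ ($\mu$ is determined by $I$). The map $\phi:\mathbb P^1\to\mathbb P^2$, $(t_0:t_1)\mapsto(u_0:u_1:u_2)(t_0,t_1)$, is proper if it is birational onto its image, the curve $C$. $\mathcal E_d(\underline X)$ is the irreducible homogeneous polynomial of degree $d$ defining $C$. A point $\mathbf p\in C$ is very singular if $\mathrm{mult}_{\mathbf p}(C)>\mu$. Coordinates are chosen so that the very singular point is $(0:0:1)$; then, with $\mu=2$, $P_{2,1}=p^1_2(\underline T)X_0-p^0_2(\underline T)X_1$ with $p^0_2,p^1_2$ homogeneous of degree 2. Operator $\mathcal D_T$: if $G_{i,j}$ has bidegree $(i,j)$ with $i\ge3$, write $G_{i,j}=p^0_2(\underline T)G^0_{i-2,j}+p^1_2(\underline T)G^1_{i-2,j}$ (possible; choose any such decomposition) and set $\mathcal D_T(G_{i,j})=X_0G^0_{i-2,j}+X_1G^1_{i-2,j}$, of bidegree $(i-2,j+1)$. With $d=2k-1$: $F_{2,1}:=P_{2,1}$, $F_{2(k-1)-1,1}:=Q_{d-2,1}$, and for $j=2,\ldots,k-1$, $F_{2(k-j)-1,j}:=\mathcal D_T\big(F_{2(k-j+1)-1,j-1}\big)$. The polynomial $F_{1,k}$ is defined as follows: write $F_{2,1}=T_0G_{1,1}(\underline T,\underline X)+T_1H_{1,1}(\underline T,\underline X)$ and $F_{1,k-1}=T_0\mathcal F^1_{k-1}(\underline X)-T_1\mathcal F^0_{k-1}(\underline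 X)$ with $\mathcal F^0_{k-1},\mathcal F^1_{k-1}\in\mathbb K[\underline X]$ homogeneous of degree $k-1$, and set $F_{1,k}:=\mathcal F^0_{k-1}(\underline X)G_{1,1}(\underline T,\underline X)+\mathcal F^1_{k-1}(\underline X)H_{1,1}(\underline T,\underline X)$. *)

(* Defs.v *)
From HB Require Import structures.
From mathcomp Require Import all_boot all_order all_algebra.
From mathcomp Require Import mpoly.

Set Implicit Arguments.
Unset Strict Implicit.
Unset Printing Implicit Defensive.

Import GRing.Theory.
Local Open Scope ring_scope.

Definition i31 : 'I_3 := Ordinal (isT : (1 < 3)%N).

(* Ideals and generators. *)

Definition in_span (A : comNzRingType) (n : nat) (D : {set 'I_n})
    (g : 'I_n -> A) (x : A) : Prop :=
  exists c : 'I_n -> A, x = \sum_(i in D) c i * g i.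

Definition generates (A : comNzRingType) (J : A -> Prop) (n : nat)
    (D : {set 'I_n}) (g : 'I_n -> A) : Prop :=
  forall x, J x <-> in_span D g x.

(* Minimality is with respect to inclusion. Since the family is indexed by
   positions, it also forces the members to be pairwise distinct. *)
Definition minimal_generators (A : comNzRingType) (J : A -> Prop)
    (s : seq A) : Prop :=
  let g (i : 'I_(size s)) := s`_i in
  generates J [set: 'I_(size s)] g /\
  forall D : {set 'I_(size s)},
    D \proper [set: 'I_(size s)] -> ~ generates J D g.

Section Defs.
Variable K : closedFieldType.

(* K[T], K[X] and K[T][X], with T = (T_0, T_1) and X = (X_0, X_1, X_2). *)
Definition KT := {mpoly K[2]}.
Definition KX := {mpoly K[3]}.
Definition KTX := {mpoly KT[3]}.

Definition T0 : KT := 'X_ord0.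
Definition T1 : KT := 'X_ord_max.
Definition X0 : KTX := 'X_ord0.
Definition X1 : KTX := 'X_i31.

Definition inX (f : KX) : KTX := map_mpoly (@mpolyC 2 K) f.

(* Degree i in T and degree j in X. *)
Definition bihomog (i j : nat) (G : KTX) : Prop :=
  G \is j.-homog /\ forall m : 'X_{1..3}, G@_m \is i.-homog.

Definition no_common_factor (u : 'I_3 -> KT) : Prop :=
  forall g : KT, (forall i, exists q, u i = g * q) -> g \is a GRing.unit.

(* Rees(I) is the graded subring (+)_n I^n Z^n of K[T][Z]; its inclusion being
   injective, the kernel may be computed with values in K[T][Z]. *)
Definition rees_map (u : 'I_3 -> KT) (G : KTX) : {poly KT} :=
  mmap (@polyC KT) (fun i => (u i)%:P * 'X) G.

Definition rees_kernel (u : 'I_3 -> KT) (G : KTX) : Prop := rees_map u G = 0.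

(* P, Q is a basis of the free K[T]-module of the elements of the kernel of
   degree 1 in X, of bidegrees (mu, 1) and (d - mu, 1) with mu <= d / 2. *)
Definition mu_basis (u : 'I_3 -> KT) (d mu : nat) (P Q : KTX) : Prop :=
  [/\ (mu.*2 <= d)%N,
      bihomog mu 1 P /\ rees_kernel u P,
      bihomog (d - mu) 1 Q /\ rees_kernel u Q
    & forall G : KTX, rees_kernel u G -> G \is 1.-homog ->
        exists! ab : KT * KT, G = ab.1 *: P + ab.2 *: Q].

(* Points of projective space are given by nonzero coordinate vectors. *)

Definition nonzero_vec (n : nat) (x : 'I_n -> K) : Prop := exists i, x i != 0.

Definition same_point (n : nat) (x y : 'I_n -> K) : Prop :=
  exists2 c : K, c != 0 & forall i, x i = c * y i.

Definition eval_all (n m : nat) (f : 'I_m -> {mpoly K[n]}) (x : 'I_n -> K) :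
    'I_m -> K :=
  fun i => (f i).@[x].

(* The image of phi : P^1 -> P^2. *)
Definition on_curve (u : 'I_3 -> KT) (p : 'I_3 -> K) : Prop :=
  exists t : 'I_2 -> K, nonzero_vec t /\ same_point p (eval_all u t).

Definition mpoly_irreducible (n : nat) (f : {mpoly K[n]}) : Prop :=
  [/\ f != 0, f \isn't a GRing.unit
    & forall g h : {mpoly K[n]}, f = g * h ->
        g \is a GRing.unit \/ h \is a GRing.unit].

Definition defines_curve (u : 'I_3 -> KT) (E : KX) : Prop :=
  forall p : 'I_3 -> K, nonzero_vec p -> (on_curve u p <-> E.@[p] = 0).

(* phi is birational onto its image C: there is a rational map from C to P^1,
   given by forms v_0, v_1 of the same degree not both vanishing identically
   on C, which is inverse to phi wherever (v_0, v_1) is nonzero. *)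
Definition proper_param (u : 'I_3 -> KT) : Prop :=
  exists (e : nat) (v : 'I_2 -> KX),
    [/\ forall i, v i \is e.-homog,
        exists p, on_curve u p /\ nonzero_vec (eval_all v p),
        forall t, nonzero_vec t -> nonzero_vec (eval_all v (eval_all u t)) ->
          same_point (eval_all v (eval_all u t)) t
      & forall p, on_curve u p -> nonzero_vec (eval_all v p) ->
          same_point (eval_all u (eval_all v p)) p].

(* The least degree of a monomial of f, for nonzero f. *)
Definition order_at0 (n : nat) (f : {mpoly K[n]}) : nat :=
  \big[minn/msize f]_(m <- msupp f) mdeg m.

(* The equation of E in the affine chart X_i = 1, with p (where p i != 0)
   translated to the origin; the variable X_i no longer occurs. *)
Definition local_equation (E : KX) (p : 'I_3 -> K) (i : 'I_3) : KX :=
  E \mPo [tuple (p j / p i)%:MP + (if j == i then 0 else 'X_j) | j < 3].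

(* A point may lie in several charts; the order does not depend on the chart. *)
Definition mult (E : KX) (p : 'I_3 -> K) : nat :=
  if [pick i | p i != 0] is Some i then order_at0 (local_equation E p i)
  else 0%N.

Definition very_singular (u : 'I_3 -> KT) (E : KX) (mu : nat)
    (p : 'I_3 -> K) : Prop :=
  on_curve u p /\ (mu < mult E p)%N.

Definition point001 : 'I_3 -> K := fun i => (i == ord_max)%:R.

(* The coefficients such that P = p1 X_0 - p0 X_1, the coefficient of X_2 in P
   being zero when (0 : 0 : 1) is very singular. *)
Definition coef_p1 (P : KTX) : KT := P@_U_(ord0).
Definition coef_p0 (P : KTX) : KT := - P@_U_(i31).

(* D is a value of D_T at G, of bidegree (i, j), for some decomposition of G. *)
Definition DT_value (P : KTX) (i j : nat) (G D : KTX) : Prop :=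
  exists G0 G1 : KTX,
    [/\ (3 <= i)%N /\ bihomog i j G,
        bihomog (i - 2) j G0,
        bihomog (i - 2) j G1,
        G = coef_p0 P *: G0 + coef_p1 P *: G1
      & D = X0 * G0 + X1 * G1].

(* F j stands for F_{2(k-j)-1,j}. *)
Definition F_sequence (P Q : KTX) (k : nat) (F : nat -> KTX) : Prop :=
  F 1 = Q /\
  forall j, (2 <= j <= k - 1)%N ->
    DT_value P (2 * (k - j + 1) - 1) (j - 1) (F (j - 1)%N) (F j).

(* L stands for F_{1,k} and F' for F_{1,k-1}. *)
Definition last_F (P F' : KTX) (k : nat) (L : KTX) : Prop :=
  exists (G H : KTX) (f0 f1 : KX),
    [/\ bihomog 1 1 G /\ bihomog 1 1 H,
        f0 \is (k - 1).-homog /\ f1 \is (k - 1).-homog,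
        P = T0 *: G + T1 *: H,
        F' = T0 *: inX f1 - T1 *: inX f0
      & L = inX f0 * G + inX f1 * H].

End Defs.

(* Main.v *)
Require Import Defs.
From mathcomp Require Import all_boot all_order all_algebra.
From mathcomp Require Import mpoly.
From mathcomp Require Import ring zify.
From Stdlib Require Import Classical ClassicalEpsilon.

(** The idea is to compute in the ring [K[T][s, y]], through the substitution
    [X0 = p0 s], [X1 = p1 s], [X2 = y] attached to the moving line
    [P = p1 X0 - p0 X1] ([conic_map]).

    The moving line [P] has no term in [X2] because [(0 : 0 : 1)] is very
    singular ([very_singular_no_X2]). Such a term would bound the degree of
    [gcd (u0, u1)] by 2, so that the projection of the parametrization from
    [(0 : 0 : 1)] would have degree at least [d - 2], whereas the equation [E] has
    degree at most [d - 3] in [X2]; for a proper parametrization this is absurd,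
    [T0 / T1] being a rational function on the curve ([projection_degree_lt]).
    Hence [p0] and [p1] are coprime quadratic forms and [u0 = p0 w], [u1 = p1 w]
    with [w] of degree [d - 2] prime to [u2] ([factor_w]).

    The kernel of the substitution is generated by [P] ([ker_conic]), and a
    polynomial lies in the kernel of the Rees map if and only if its image is
    divisible by [lam = w y - u2 s] ([rees_kernel_quotient]). Since
    [p0 s = X0] and [p1 s = X1], the operator [D_T] is multiplication by [s]
    ([conic_DT]). Up to one nonzero constant, [F j] is therefore sent to
    [lam s ^ (j - 1)], and the last generator [L] to
    [lam s ^ (k - 2) (q s + c y)], where [q] is the Sylvester form of [p0] and
    [p1] ([last_F_facts]).

    Generation: let [G] be in the kernel. Its part of degree 0 in [T] vanishes on
    the curve, hence is a multiple of [E], which is prime because polynomial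
    rings over a field are factorial ([prime_divides_curve_kernel]). For the rest,
    the image is [lam] times a combination of terms [e s ^ l y ^ c], and counting
    degrees in [T] shows that [e] vanishes at the origin to order at least
    [2 (l - (k - 2))] ([ord_quotient]). For [l <= k - 2] the term is reached by
    [F (l + 1)]. The remaining powers of [s] are absorbed two degrees at a time:
    quadratic forms are spanned by [p0], [p1] and [q], and a form of degree
    [n >= 3] is [p0 a + p1 b] with [a] and [b] of degree [n - 2], so that [X0],
    [X1] and [L] suffice ([in_image_high]).

    Minimality: the generators have distinct bidegrees, so that a redundant one
    could only be expressed through generators of smaller bidegree. Looking at a
    single coefficient in [s] excludes this; for [L] it would make [q] a
    combination of [p0] and [p1], which it is not since [q] generates the socle of
    [K[T] / (p0, p1)] ([sylvester_form_notin]). *)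

Set Implicit Arguments.
Unset Strict Implicit.
Unset Printing Implicit Defensive.

Import GRing.Theory.
Local Open Scope ring_scope.

(** * Factorial domains and the Gauss lemma *)

Section Divisibility.
Variable R : idomainType.
Implicit Types a b c p q x : R.

Definition divides a b := exists q, b = a * q.

Definition prime_elt p :=
  [/\ p != 0, p \isn't a GRing.unit
    & forall a b, divides p (a * b) -> divides p a \/ divides p b].

Definition irreducible_elt p :=
  [/\ p != 0, p \isn't a GRing.unit
    & forall a b, p = a * b -> a \is a GRing.unit \/ b \is a GRing.unit].

Definition rel_prime a b :=
  forall g, divides g a -> divides g b -> g \is a GRing.unit.

Definition factorial_ring := forall x, x != 0 ->
  exists (v : R) (s : seq R),
    [/\ v \is a GRing.unit, forall p, p \in s -> prime_elt p
      & x = v * \prod_(p <- s) p].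

Lemma divides_trans a b c : divides a b -> divides b c -> divides a c.
Proof. by move=> [x ->] [y ->]; exists (x * y); rewrite mulrA. Qed.

Lemma divides_mull a b c : divides a b -> divides a (b * c).
Proof. by move=> [x ->]; exists (x * c); rewrite mulrA. Qed.

Lemma divides_mulr a b c : divides a c -> divides a (b * c).
Proof. by move=> ?; rewrite mulrC; exact: divides_mull. Qed.

Lemma divides_add a b c : divides a b -> divides a c -> divides a (b + c).
Proof. by move=> [x ->] [y ->]; exists (x + y); rewrite mulrDr. Qed.

Lemma divides_refl a : divides a a.
Proof. by exists 1; rewrite mulr1. Qed.

Lemma rel_primeC a b : rel_prime a b -> rel_prime b a.
Proof. by move=> h g ga gb; exact: h. Qed.

Lemma factorial_ind (P : R -> Prop) : factorial_ring ->
  (forall v, v \is a GRing.unit -> P v) ->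
  (forall p x, prime_elt p -> x != 0 -> P x -> P (p * x)) ->
  forall x, x != 0 -> P x.
Proof.
move=> fR Pu Pp x x0; have [v [s [vu sp xE]]] := fR x x0.
rewrite {}xE {x} in x0 *; elim: s sp x0 => [|p s IH] sp.
  by rewrite big_nil mulr1 => _; exact: Pu.
rewrite big_cons mulrCA mulf_eq0 negb_or => /andP [p0 x0].
apply: Pp => //; first by apply: sp; rewrite mem_head.
by apply: IH => // q qs; apply: sp; rewrite inE qs orbT.
Qed.

(** Only [a] needs to be factored: a prime of [a] cannot divide [b], hence
    divides [c] and can be cancelled. *)
Lemma rel_prime_divides a b c : factorial_ring -> a != 0 ->
  rel_prime a b -> divides a (b * c) -> divides a c.
Proof.
move=> fR a0; move: a a0 b c; apply: (factorial_ind fR) => [v vu b c _ _|].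
  by exists (v^-1 * c); rewrite mulVKr.
move=> p x pp x0 IH b c co [q bcE]; have [p0 pu pdiv] := pp.
have [] : divides p b \/ divides p c.
- by apply: pdiv; exists (x * q); rewrite bcE mulrA.
- move=> pb; have := co p (divides_mull _ (divides_refl p)) pb.
  by rewrite (negbTE pu).
move=> [c' cE]; rewrite {}cE in bcE *.
have [] : divides x c'.
  apply: (IH b) => [g gx gb|].
    by apply: co gb; apply: divides_mulr.
  by exists q; apply: (mulfI p0); rewrite mulrCA bcE mulrA.
by move=> y ->; exists y; rewrite mulrA.
Qed.

(** The primes of [a] are tried one after the other: those dividing what is left
    of [b] are moved into [h]. *)
Lemma gcd_exists a b : factorial_ring -> a != 0 ->
  exists h a' b', [/\ a = h * a', b = h * b' & rel_prime a' b'].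
Proof.
move=> fR a0; move: a a0 b; apply: (factorial_ind fR) => [v vu b|p x pp x0 IH b].
  exists 1, v, b; rewrite !mul1r; split=> // g [y vE] _.
  by move: vu; rewrite vE unitrM => /andP [].
have [p0 pu pdiv] := pp.
have [[b1 ->]|npb] := classic (divides p b).
  have [h [a' [b' [-> -> co]]]] := IH b1.
  by exists (p * h), a', b'; rewrite !mulrA.
have [h [a' [b' [-> bE co]]]] := IH b.
exists h, (p * a'), b'; split=> //; first by rewrite mulrCA.
move=> g [y pa] gb.
have [] : divides p g \/ divides p y.
- by apply: pdiv; exists a'.
- move=> pg; case: npb; rewrite bE; apply: divides_mulr.
  exact: divides_trans gb.
move=> [y' yE]; apply: co gb; exists y'; apply: (mulfI p0).
by rewrite pa yE mulrCA.
Qed.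

End Divisibility.

Section PolyFactorial.
Variable R : idomainType.
Implicit Types (a b c p : R) (f g h : {poly R}).

(** If [p] divides [f * g], it divides the product of the leading
    coefficients, so one of the leading terms can be removed. *)
Lemma prime_polyC p : prime_elt p -> prime_elt p%:P.
Proof.
move=> [p0 pu pdiv]; split; first by rewrite polyC_eq0.
  by rewrite poly_unitE coefC size_polyC p0 /=.
have lead_step f1 : f1 != 0 -> divides p (lead_coef f1) ->
    exists2 f2 : {poly R}, (size f2 < size f1)%N & exists q, f1 = f2 + p%:P * q.
  move=> f10 [q qE]; exists (f1 - lead_coef f1 *: 'X^((size f1).-1)).
    rewrite [X in (_ < X)%N](polySpred f10) ltnS; apply/leq_sizeP => j lej.
    rewrite coefB coefZ coefXn; have [->|jn] := eqVneq j (size f1).-1.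
      by rewrite mulr1 subrr.
    rewrite mulr0 subr0; apply: nth_default.
    by apply: leq_trans (leqSpred _) _; rewrite ltn_neqAle eq_sym jn.
  exists (q *: 'X^((size f1).-1)).
  by rewrite qE mul_polyC scalerA subrK.
move=> f g; have [n le_n] := ubnP (size f + size g).
elim: n f g le_n => // n IH f g le_n.
have [->|f0] := eqVneq f 0; first by left; exists 0; rewrite mulr0.
have [->|g0] := eqVneq g 0; first by right; exists 0; rewrite mulr0.
move=> [q qE].
have [] : divides p (lead_coef f) \/ divides p (lead_coef g).
- apply: pdiv; exists (lead_coef q).
  by rewrite -lead_coefM qE lead_coefM lead_coefC.
- move=> /(lead_step _ f0) [f2 lt2 [r fE]].
  have [] : divides p%:P f2 \/ divides p%:P g.
  + apply: IH; first by move: lt2 le_n; lia.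
    by exists (q - r * g); rewrite mulrBr -qE fE; ring.
  + by left; rewrite fE; apply: divides_add => //; exists r.
  + by right.
move=> /(lead_step _ g0) [g2 lt2 [r gE]].
have [] : divides p%:P f \/ divides p%:P g2.
+ apply: IH; first by move: lt2 le_n; lia.
  by exists (q - r * f); rewrite mulrBr -qE gE; ring.
+ by left.
by right; rewrite gE; apply: divides_add => //; exists r.
Qed.

(** The primes of the constant [c] are distributed one by one over the two
    factors: this is the Gauss lemma in the form of clearing denominators. *)
Lemma gauss c f g h : factorial_ring R -> c != 0 -> c%:P * f = g * h ->
  exists (c1 c2 : R) (g' h' : {poly R}),
    [/\ g = c1%:P * g', h = c2%:P * h', f = g' * h', c1 != 0 & c2 != 0].
Proof.
move=> fR c0; move: c c0 f g h; apply: (factorial_ind fR).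
  move=> v vu f g h E; exists v, 1, (v^-1%:P * g), h.
  have vv : v%:P * v^-1%:P = 1 :> {poly R} by rewrite -polyCM divrr.
  rewrite mul1r mulrA vv mul1r oner_eq0; split=> //.
    by rewrite -mulrA -E mulrA [v^-1%:P * _]mulrC vv mul1r.
  by apply: contraTneq vu => ->; rewrite unitr0.
move=> p x pp x0 IH f g h.
have /prime_polyC [p0 pu pdiv] := pp.
rewrite polyCM -mulrA => E.
have [] : divides p%:P g \/ divides p%:P h by apply: pdiv; exists (x%:P * f).
- move=> [g1 gE]; rewrite gE -mulrA in E.
  have [c1 [c2 [g' [h' [g1E -> -> c10 c20]]]]] := IH f g1 h (mulfI p0 E).
  exists (p * c1), c2, g', h'; rewrite polyCM -mulrA -g1E; split=> //.
  by rewrite mulf_neq0 //; case: pp.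
move=> [h1 hE]; rewrite hE [RHS]mulrCA in E.
have [c1 [c2 [g' [h' [-> h1E -> c10 c20]]]]] := IH f g h1 (mulfI p0 E).
exists c1, (p * c2), g', h'; rewrite polyCM -mulrA -h1E; split=> //.
by rewrite mulf_neq0 //; case: pp.
Qed.

Lemma poly_nonunit f : (1 < size f)%N -> f \isn't a GRing.unit.
Proof. by rewrite poly_unitE; case: eqP => // ->. Qed.

(** By the Gauss lemma [c] splits into a constant factor of [f], which is a unit
    by irreducibility, and a constant factor of the quotient. *)
Lemma irreducible_divides_const c f g : factorial_ring R ->
  irreducible_elt f -> (1 < size f)%N -> c != 0 ->
  divides f (c%:P * g) -> divides f g.
Proof.
move=> fR [f0 fu fi] sf c0 [q qE].
have [c1 [c2 [f' [q' [fE qE' -> c10 c20]]]]] := gauss fR c0 qE.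
have [] := fi _ _ fE; last first.
  move=> f'u; move: (poly_nonunit sf).
  move: f'u; rewrite poly_unitE => /andP [/eqP f'1 _].
  by move: sf; rewrite fE mul_polyC size_scale // f'1.
move=> c1u; apply: divides_mull; exists c1^-1%:P.
rewrite fE mulrAC -polyCM divrr ?mul1r //.
by move: c1u; rewrite poly_unitE coefC => /andP [].
Qed.

(** Up to constants an irreducible polynomial is irreducible over the field of
    fractions, where it is prime by the Euclidean algorithm; the constants are
    then removed by the Gauss lemma. *)
Lemma irreducible_poly_prime f : factorial_ring R ->
  (forall c : R, irreducible_elt c -> prime_elt c) ->
  irreducible_elt f -> prime_elt f.
Proof.
move=> fR prR if_; have [f0 fu fi] := if_.
have [sf|sf] := leqP (size f) 1.
  have fE : f = (f`_0)%:P by apply: size1_polyC.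
  have c0 : f`_0 != 0 by rewrite -polyC_eq0 -fE.
  rewrite fE; apply: prime_polyC; apply: prR.
  split=> //.
    by apply: contra fu => cu; rewrite fE poly_unitE size_polyC coefC cu c0.
  move=> a b E; have [] : a%:P \is a GRing.unit \/ b%:P \is a GRing.unit.
  - by apply: fi; rewrite fE E polyCM.
  - by rewrite poly_unitE coefC => /andP [_]; left.
  - by rewrite poly_unitE coefC => /andP [_]; right.
have irr : irreducible_poly f.
  split=> // q sq /Pdiv.Idomain.dvdpP [[c r] /= c0 E].
  rewrite mulrC -mul_polyC in E.
  have [c1 [c2 [q' [r' [qE rE fE c10 c20]]]]] := gauss fR c0 E.
  have r'1 : size r' = 1.
    have [] := fi _ _ fE; last by rewrite poly_unitE => /andP [/eqP].
    rewrite poly_unitE => /andP [/eqP q'1 _].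
    by move: sq; rewrite qE mul_polyC size_scale // q'1.
  rewrite -dvdp_size_eqp; last first.
    by apply/Pdiv.Idomain.dvdpP; exists (c, r); rewrite //= -mul_polyC E mulrC.
  rewrite qE fE mul_polyC size_scale // size_mul ?r'1 ?addn1 //.
    by apply: contraNneq f0 => q'0; rewrite fE q'0 mul0r.
  by rewrite -size_poly_eq0 r'1.
have divc (g : {poly R}) : (f %| g)%R -> divides f g.
  move=> /Pdiv.Idomain.dvdpP [[c r] /= c0 E].
  apply: (irreducible_divides_const fR if_ sf c0).
  by exists r; rewrite mul_polyC E mulrC.
split=> // g h [q ghE].
have : ~~ coprimep f (g * h).
  rewrite (irreducible_poly_coprime _ irr) negbK.
  by apply/Pdiv.Idomain.dvdpP; exists (1, q); rewrite ?oner_eq0 //= scale1r ghE mulrC.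
rewrite coprimepMr negb_and !(irreducible_poly_coprime _ irr) !negbK.
by case/orP => /divc; [left|right].
Qed.

End PolyFactorial.

(** * Polynomial rings over a field are factorial *)

Section MpolyFactorial.

Section Uni.
Variables (n : nat) (R : idomainType).

(** The inverse of [muni], which views the last variable as the variable of a
    univariate polynomial. *)
Definition muni_inv (q : {poly {mpoly R[n]}}) : {mpoly R[n.+1]} :=
  (map_poly (@mwiden n R) q).['X_ord_max].

Lemma muniX m : muni 'X_[m] =
  'X_[[multinom (m (widen_ord (leqnSn n) i)) | i < n]] *: 'X^(m ord_max)
  :> {poly {mpoly R[n]}}.
Proof. by rewrite muniE msuppX big_seq1 mcoeffX eqxx scale1r. Qed.

Lemma muniXmax : muni 'X_ord_max = 'X :> {poly {mpoly R[n]}}.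
Proof.
rewrite muniX mnm1E eqxx; rewrite (_ : [multinom _ | i < n] = 0%MM).
  by rewrite mpolyX0 scale1r.
apply/mnmP => i; rewrite mnmE mnm1E mnm0E; case: eqP => // /(congr1 val) /= E.
by have := ltn_ord i; rewrite -E ltnn.
Qed.

Lemma muni_mwiden (c : {mpoly R[n]}) : muni (mwiden c) = c%:P.
Proof.
elim/mpolyind: c => [|a m p _ _ IH]; first by rewrite !raddf0.
rewrite !raddfD /= IH mwidenZ mwidenX; congr (_ + _).
rewrite muniZ muniX -mul_polyC -mul_mpolyC polyCM; congr (_ * _).
rewrite mnmwiden_ordmax expr0 alg_polyC; congr _%:P; congr 'X_[_].
by apply/mnmP => i; rewrite mnmE mnmwiden_widen.
Qed.

Lemma muni_invK : cancel muni_inv (@muni n R).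
Proof.
elim/poly_ind => [|q c IH]; first by rewrite /muni_inv raddf0 horner0 raddf0.
rewrite /muni_inv rmorphD rmorphM /= map_polyX map_polyC hornerMXaddC.
by rewrite muniD muniM [X in X * _]IH muniXmax muni_mwiden.
Qed.

Lemma muniK : cancel (@muni n R) muni_inv.
Proof.
elim/mpolyind => [|a m p _ _ IH]; first by rewrite raddf0 /muni_inv raddf0 horner0.
have E (f g : {mpoly R[n.+1]}) :
    muni_inv (muni (f + g)) = muni_inv (muni f) + muni_inv (muni g).
  by rewrite /muni_inv muniD raddfD hornerD.
rewrite E [X in _ + X]IH.
apply: (congr1 (+%R^~ p)).
rewrite muniZ muniX /muni_inv scalerA map_polyZ map_polyXn hornerZ hornerXn.
rewrite /= mul_mpolyC mwidenZ mwidenX mpolyXn -scalerAl -mpolyXD; congr (_ *: 'X_[_]).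
apply/mnmP => i; rewrite mnmDE mulmnE mnm1E.
have [j ->|->] := unliftP ord_max i; last first.
  by rewrite mnmwiden_ordmax eqxx mul1n.
rewrite (_ : lift _ j = widen_ord (leqnSn n) j); last first.
  by apply: val_inj; rewrite /= /bump leqNgt ltn_ord.
by rewrite mnmwiden_widen mnmE -val_eqE /= gtn_eqF // mul0n addn0.
Qed.

Lemma muni_inj : injective (@muni n R).
Proof. exact: can_inj muniK. Qed.

Lemma muni_divides (f g : {mpoly R[n.+1]}) : divides (muni f) (muni g) -> divides f g.
Proof.
by move=> [q E]; exists (muni_inv q); apply: muni_inj; rewrite muniM E muni_invK.
Qed.

Lemma muni_unit (f : {mpoly R[n.+1]}) : (muni f \is a GRing.unit) = (f \is a GRing.unit).
Proof.
apply/idP/idP => fu; last exact: rmorph_unit.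
apply/unitrP; exists (muni_inv (muni f)^-1).
have h : f * muni_inv (muni f)^-1 = 1.
  by apply: muni_inj; rewrite muniM muni_invK divrr // muni1.
by rewrite mulrC.
Qed.

End Uni.

Section Field.
Variable K : fieldType.

Lemma mpoly_unitE n (f : {mpoly K[n]}) : (f \is a GRing.unit) = (msize f == 1%N).
Proof.
apply/idP/msize_poly1P => [|[c c0 ->]].
  move=> /andP [/eqP fE fu]; exists f@_0 => //.
  by apply: contraTneq fu => ->; rewrite unitr0.
by rewrite qualifE /= /mpoly_unit mpolyCK eqxx unitfE.
Qed.

(** Induction on the degree, which drops in both factors of a reducible element. *)
Lemma mpoly_factorial_of n :
  (forall f : {mpoly K[n]}, irreducible_elt f -> prime_elt f) ->
  factorial_ring {mpoly K[n]}.
Proof.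
move=> irr_prime f; have [d] := ubnP (msize f); elim: d f => // d IH f le_d f0.
have [fu|fu] := boolP (f \is a GRing.unit).
  by exists f, [::]; rewrite big_nil mulr1.
have [/irr_prime fp|nfi] := classic (irreducible_elt f).
  exists 1, [:: f]; rewrite unitr1 big_seq1 mul1r; split=> // p.
  by rewrite inE => /eqP ->.
have [g [h [fE gu hu]]] : exists g h : {mpoly K[n]},
    [/\ f = g * h, g \isn't a GRing.unit & h \isn't a GRing.unit].
  apply: NNPP => nex; apply: nfi; split=> // g h fE.
  have [|gu] := boolP (g \is a GRing.unit); first by left.
  have [|hu] := boolP (h \is a GRing.unit); first by right.
  by case: nex; exists g, h.
have : f != 0 by []. rewrite {1}fE mulf_eq0 negb_or => /andP [g0 h0].
have := msizeM g0 h0; rewrite -fE => sf.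
rewrite !mpoly_unitE in gu hu.
move: (g0) (h0); rewrite -!msize_poly_eq0 => sg sh.
have small a b c : c = (a + b).-1 -> a != 0 -> b != 0 -> a != 1 -> b != 1 ->
  (c < d.+1 -> (a < d) /\ (b < d))%N by lia.
have [lt_g lt_h] := small _ _ _ sf sg sh gu hu le_d.
have [v [s [vu sp gE]]] := IH g lt_g g0.
have [w [t [wu tp hE]]] := IH h lt_h h0.
exists (v * w), (s ++ t); split.
- by rewrite unitrM vu.
- by move=> p; rewrite mem_cat => /orP [/sp|/tp].
by rewrite big_cat /= fE gE hE; ring.
Qed.

(** Induction on the number of variables: [muni] reduces the step to the transfer
    of factoriality from [R] to polynomials over [R]. *)
Lemma mpoly_irreducible_prime n (f : {mpoly K[n]}) :
  irreducible_elt f -> prime_elt f.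
Proof.
elim: n f => [|n IH] f if_; have [f0 fu fi] := if_.
  case/negP: fu; rewrite mpoly_unitE; apply/msize_poly1P.
  exists f@_0%MM; last exact: nvar0_mpolyC.
  by apply: contraNneq f0 => f00; rewrite (nvar0_mpolyC f) f00.
have [] := @irreducible_poly_prime _ (muni f) (mpoly_factorial_of IH) IH.
  split; rewrite ?muni_unit //.
    by apply: contra f0 => /eqP fE; apply/eqP/muni_inj; rewrite fE muni0.
  move=> g h E; have gE := muni_invK g; have hE := muni_invK h.
  have fE : f = muni_inv g * muni_inv h.
    apply: muni_inj; rewrite E muniM.
    by apply: etrans (f_equal2 _ (esym gE) (esym hE)) _.
  case: (fi _ _ fE); rewrite -muni_unit.
    by rewrite gE; left.
  by rewrite hE; right.
move=> _ _ pdiv; split=> // g h [q E].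
have [] := pdiv (muni g) (muni h); last 2 first.
- by move=> /muni_divides; left.
- by move=> /muni_divides; right.
exists (muni q); apply: etrans (esym (muniM g h)) _; rewrite E.
exact: muniM.
Qed.

Lemma mpoly_factorial n : factorial_ring {mpoly K[n]}.
Proof. exact/mpoly_factorial_of/mpoly_irreducible_prime. Qed.

End Field.
End MpolyFactorial.
(* Unification may not unfold [muni], whose value is a large sum. *)
Opaque muni.

(** * Homogeneous parts, orders of vanishing and syzygies of powers *)

Section Homogeneous.
Variables (n : nat) (R : comNzRingType).
Implicit Types (p q : {mpoly R[n]}) (m : 'X_{1..n}).

Lemma mcoeff_pihomog i p m :
  (pihomog mdeg i p)@_m = if mdeg m == i then p@_m else 0.
Proof.
elim/mpolyind: p => [|c m' p _ _ IH]; first by rewrite raddf0 mcoeff0 if_same.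
rewrite linearD linearZ /= !mcoeffD IH !mcoeffZ pihomogX !mcoeffX.
have [<-|ne] := eqVneq m' m.
  by case: eqP; rewrite ?mcoeffX ?eqxx // mcoeff0 mulr0 addr0.
rewrite mulr0 add0r; case: (mdeg m' == i); last by rewrite mcoeff0 mulr0 add0r.
by rewrite mcoeffX (negbTE ne) mulr0 add0r.
Qed.

Lemma pihomogMl e i p q : p \is e.-homog ->
  pihomog mdeg (e + i) (p * q) = p * pihomog mdeg i q.
Proof.
move=> ph; elim/mpolyind: q => [|c m q _ _ IH].
  by rewrite mulr0 !raddf0 mulr0.
rewrite mulrDr !raddfD /= IH mulrDr -scalerAr !linearZ /= -scalerAr pihomogX.
congr (_ *: _ + _); have hom : p * 'X_[m] \is (e + mdeg m).-homog.
  by apply: dhomogM => //; rewrite dhomogX.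
case: eqP => [<-|ne]; first by rewrite pihomog_dE.
by rewrite mulr0 (pihomog_ne0 _ hom) // eqn_add2l; apply/eqP.
Qed.

Lemma pihomogMl_small e i p q : p \is e.-homog -> (i < e)%N ->
  pihomog mdeg i (p * q) = 0.
Proof.
move=> ph lt; elim/mpolyind: q => [|c m q _ _ IH]; first by rewrite mulr0 raddf0.
rewrite mulrDr raddfD /= IH addr0 -scalerAr linearZ /=.
have hom : p * 'X_[m] \is (e + mdeg m).-homog by apply: dhomogM; rewrite ?dhomogX.
by rewrite (pihomog_ne0 _ hom) ?scaler0 // gtn_eqF // ltn_addr.
Qed.

(** Membership in the [i]-th power of the ideal generated by the variables. *)
Definition ord_ge i p := forall m, p@_m != 0 -> (i <= mdeg m)%N.

Lemma ord_geP i p : ord_ge i p <-> forall j, (j < i)%N -> pihomog mdeg j p = 0.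
Proof.
split=> [h j lt|h m nz].
  apply/mpolyP => m; rewrite mcoeff_pihomog mcoeff0; case: eqP => // mj.
  by apply/eqP; apply: contraTT lt => /h; rewrite mj -leqNgt.
rewrite leqNgt; apply: contraNN nz => /h /(congr1 (mcoeff m)).
by rewrite mcoeff_pihomog eqxx mcoeff0 => ->.
Qed.

Lemma ord_ge0 p : ord_ge 0 p.
Proof. by []. Qed.

Lemma ord_ge_zero i : ord_ge i 0.
Proof. by move=> m; rewrite mcoeff0 eqxx. Qed.

Lemma ord_geW i j p : (j <= i)%N -> ord_ge i p -> ord_ge j p.
Proof. by move=> le h m /h; exact: leq_trans. Qed.

Lemma ord_geD i p q : ord_ge i p -> ord_ge i q -> ord_ge i (p + q).
Proof.
move=> /ord_geP hp /ord_geP hq; apply/ord_geP => j lt.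
by rewrite raddfD /= hp // hq // addr0.
Qed.

Lemma ord_ge_sum I (r : seq I) (P : pred I) (F : I -> {mpoly R[n]}) i :
  (forall x, P x -> ord_ge i (F x)) -> ord_ge i (\sum_(x <- r | P x) F x).
Proof.
move=> h; elim/big_ind: _ => //; first exact: ord_ge_zero.
by move=> ? ?; exact: ord_geD.
Qed.

Lemma ord_ge_homog i p : p \is i.-homog -> ord_ge i p.
Proof. by move=> /dhomogP h m; rewrite -mcoeff_msupp => /h ->. Qed.

Lemma ord_geM i j p q : ord_ge i p -> ord_ge j q -> ord_ge (i + j) (p * q).
Proof.
move=> hp hq m; rewrite -mcoeff_msupp => /msuppM_le /allpairsP [[m1 m2] /= []].
by rewrite !mcoeff_msupp => /hp le1 /hq le2 ->; rewrite mdegD leq_add.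
Qed.

Lemma ord_geMl i p q : ord_ge i p -> ord_ge i (p * q).
Proof. by move=> hp; rewrite -[i]addn0; apply: ord_geM. Qed.

End Homogeneous.

Section HomogeneousDomain.
Variables (n : nat) (R : idomainType).
Implicit Types (p q : {mpoly R[n]}) (m : 'X_{1..n}).

(** Multiplying by a form shifts homogeneous parts, without cancellation between
    different degrees. *)
Lemma ord_ge_cancel e i p q : p \is e.-homog -> p != 0 ->
  ord_ge (e + i) (p * q) -> ord_ge i q.
Proof.
move=> ph p0 /ord_geP h; apply/ord_geP => j lt.
have := h (e + j)%N; rewrite ltn_add2l => /(_ lt); rewrite (pihomogMl _ _ ph).
by move/eqP; rewrite mulf_eq0 (negbTE p0) => /eqP.
Qed.

Lemma msize_homog i p : p \is i.-homog -> p != 0 -> msize p = i.+1.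
Proof.
move=> ph p0; have := dhomog_msize ph => /(dhomog_uniq p0 ph) ->.
by rewrite prednK // lt0n msize_poly_eq0.
Qed.

Lemma divides_msize p q : divides p q -> q != 0 -> (msize p <= msize q)%N.
Proof.
move=> [r ->]; rewrite mulf_eq0 negb_or => /andP [p0 r0].
rewrite msizeM // -subn1 -addnBA ?leq_addr //.
by rewrite lt0n msize_poly_eq0.
Qed.

End HomogeneousDomain.

Section SyzygyPowers.
Variable R : idomainType.
Implicit Types a b c : R.

Lemma rel_prime_divides_exp a b c j : factorial_ring R -> a != 0 ->
  rel_prime a b -> divides a (b ^+ j * c) -> divides a c.
Proof.
move=> fR a0 co; elim: j => [|j IH]; first by rewrite expr0 mul1r.
by rewrite exprS -mulrA => /(rel_prime_divides fR a0 co).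
Qed.

(** The [g l] are the coefficients of a form in [(x, y)] vanishing at [(a, b)], and
    the [e l] those of its quotient by the linear form [a * y - b * x]. Modulo [a]
    only the term in [b ^+ j] survives, so [a] divides [g 0]; removing this term
    and dividing by [a] lowers [j]. *)
Lemma syzygy_powers a b j (g : nat -> R) : factorial_ring R -> a != 0 ->
  rel_prime a b -> \sum_(l < j.+1) g l * (a ^+ l * b ^+ (j - l)) = 0 ->
  exists e : nat -> R, e j = 0 /\
    forall l, (l <= j)%N ->
      g l = a * e l - b * (if l is l'.+1 then e l' else 0).
Proof.
move=> fR a0 co; elim: j g => [|j IH] g.
  rewrite big_ord1 expr0 mulr1 mulr1 => g0; exists (fun=> 0).
  by split=> // l; rewrite leqn0 => /eqP ->; rewrite g0 !mulr0 subr0.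
rewrite big_ord_recl /= expr0 mul1r subn0.
under eq_bigr do rewrite /bump /= add1n subSS exprS.
move=> E; have [e0 e0E] : divides a (g 0%N).
  apply: (rel_prime_divides_exp (j := j.+1) fR a0 co).
  exists (- \sum_(i < j.+1) g i.+1 * (a ^+ i * b ^+ (j - i))).
  move: E; rewrite mulrC => /eqP; rewrite addr_eq0 => /eqP ->.
  rewrite mulrN mulr_sumr; congr (- _); apply: eq_bigr => i _.
  by rewrite -!mulrA mulrCA.
pose g' l := g l.+1 + (l == 0%N)%:R * (b * e0).
have [|e [ej eE]] := IH g'.
  apply: (mulfI a0); rewrite mulr0; apply: etrans E.
  rewrite mulr_sumr !big_ord_recl /= e0E /g' /= !subn0 exprS expr0 !mul1r.
  rewrite addrA; congr (_ + _); first by ring.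
  by apply: eq_bigr => i _; rewrite mul0r addr0; ring.
exists (fun l => if l is l'.+1 then e l' else e0); split=> //.
case=> [|l] le_l; first by rewrite mulr0 subr0.
have := eE l le_l; rewrite /g'; case: l {le_l} => [|l] /=.
  rewrite mul1r mulr0 subr0 => <-; ring.
by rewrite mul0r addr0.
Qed.

End SyzygyPowers.

(** * Binary forms *)

Definition mon2 (i j : nat) : 'X_{1..2} := (U_(ord0) *+ i + U_(ord_max) *+ j)%MM.

Lemma mon2_0 i j : mon2 i j ord0 = i.
Proof. by rewrite mnmDE !mulmnE !mnm1E /= mul1n mul0n addn0. Qed.

Lemma mon2_1 i j : mon2 i j ord_max = j.
Proof. by rewrite mnmDE !mulmnE !mnm1E /= mul1n mul0n. Qed.

Lemma mon2K (m : 'X_{1..2}) : m = mon2 (m ord0) (m ord_max).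
Proof.
apply/mnmP => i; have [->|->] : i = ord0 \/ i = ord_max.
- by case: i => [[|[|//]] lt]; [left|right]; apply: val_inj.
- by rewrite mon2_0.
- by rewrite mon2_1.
Qed.

Lemma mdeg_mon2 i j : mdeg (mon2 i j) = (i + j)%N.
Proof. by rewrite mdegD !mdegMn !mdeg1 !mul1n. Qed.

Lemma mdeg2 (m : 'X_{1..2}) : mdeg m = (m ord0 + m ord_max)%N.
Proof. by rewrite {1}[m]mon2K mdeg_mon2. Qed.

Section BinaryForms.
Variable K : fieldType.
Implicit Types (f g a b : {mpoly K[2]}).

Lemma mpolyX_mon2 i j :
  'X_[mon2 i j] = 'X_ord0 ^+ i * 'X_ord_max ^+ j :> {mpoly K[2]}.
Proof. by rewrite mpolyXD !mpolyXn. Qed.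

Definition bform (e : nat) (c : nat -> K) : {mpoly K[2]} :=
  \sum_(i < e) c i *: 'X_[mon2 i (e.-1 - i)].

Lemma bform_homog e c : bform e c \is e.-1.-homog.
Proof.
apply: rpred_sum => i _; apply: rpredZ; rewrite dhomogX /= mdeg_mon2.
by rewrite subnKC //; case: e i => [[]|e] //= i; rewrite -ltnS.
Qed.

Lemma mcoeff_bform e c i : (i < e)%N -> (bform e c)@_(mon2 i (e.-1 - i)) = c i.
Proof.
move=> lt; rewrite raddf_sum /= (bigD1 (Ordinal lt)) //= mcoeffZ mcoeffX eqxx.
rewrite mulr1 big1 ?addr0 // => j; rewrite -val_eqE /= => ne.
rewrite mcoeffZ mcoeffX; case: eqP; last by rewrite mulr0.
move=> /(congr1 (fun m : 'X_{1..2} => m ord0)); rewrite !mon2_0 => /eqP.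
by rewrite (negbTE ne).
Qed.

Lemma bform_eq0 e c : bform e c = 0 -> forall i, (i < e)%N -> c i = 0.
Proof. by move=> E i lt; rewrite -(mcoeff_bform c lt) E mcoeff0. Qed.

Lemma homog_bform n f : f \is n.-homog ->
  f = bform n.+1 (fun i => f@_(mon2 i (n - i))).
Proof.
move=> fh; apply/mpolyP => m; have [mn|mn] := eqVneq (mdeg m) n; last first.
  rewrite !(@dhomog_nemf_coeff _ _ mdeg n) //; exact: bform_homog.
have mE : m = mon2 (m ord0) (n - m ord0).
  by rewrite {1}[m]mon2K -mn mdeg2 addKn.
rewrite {2}mE (mcoeff_bform (e := n.+1)) -?mE //.
by rewrite ltnS -mn mdeg2 leq_addr.
Qed.

Lemma bform_msize e c : (msize (bform e c) <= e)%N.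
Proof.
have [->|nz] := eqVneq (bform e c) 0; first by rewrite msize0.
rewrite (msize_homog (bform_homog e c) nz).
by case: e nz => [|e] //; rewrite /bform big_ord0 eqxx.
Qed.

(** The monomials of degree [e - 1] are independent over the subring [K[a, b]]
    when [b] has degree at least [e]: modulo [b] only the terms in [a ^+ r]
    survive, and [b] is too large to divide their coefficient. *)
Lemma monomials_indep a b e r (c : nat -> nat -> K) :
  rel_prime a b -> (e < msize b)%N ->
  \sum_(i < e) 'X_[mon2 i (e.-1 - i)] *
     (\sum_(j < r.+1) c i j *: (a ^+ j * b ^+ (r - j))) = 0 ->
  forall i j, (i < e)%N -> (j <= r)%N -> c i j = 0.
Proof.
move=> co ltb; have b0 : b != 0 by rewrite -msize_poly_eq0 -lt0n (leq_ltn_trans _ ltb).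
elim: r => [|r IH] E i j lti lej.
  move: lej; rewrite leqn0 => /eqP ->.
  apply: (bform_eq0 (e := e) (c := c^~ 0%N)) lti; rewrite -[RHS]E.
  apply: eq_bigr => l _; rewrite big_ord1 expr0 mulr1 -scalerAr mulr1 //.
(* Modulo [b] only the terms in [a ^+ r.+1] are left. *)
have top : bform e (c^~ r.+1) = 0.
  apply: contraTeq ltb => nz; rewrite -leqNgt.
  apply: leq_trans (bform_msize e (c^~ r.+1)).
  apply: divides_msize nz.
  apply: (rel_prime_divides_exp (j := r.+1) (@mpoly_factorial _ _) b0 (rel_primeC co)).
  exists (- \sum_(i < e) 'X_[mon2 i (e.-1 - i)] *
     (\sum_(j < r.+1) c i j *: (a ^+ j * b ^+ (r - j)))).
  rewrite mulrN /bform !mulr_sumr; apply/eqP; rewrite -addr_eq0 -[X in _ == X]E.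
  rewrite -big_split /=; apply/eqP; apply: eq_bigr => l _.
  rewrite [in RHS]big_ord_recr /= subnn expr0 mulr1 mulrDr addrC; congr (_ + _).
    rewrite mulrCA; congr (_ * _); rewrite mulr_sumr; apply: eq_bigr => q _.
    by rewrite -scalerAr mulrCA -exprS subSn // -ltnS.
  by rewrite -!scalerAr mulrC.
have [->|ne] := eqVneq j r.+1; first exact: (bform_eq0 top).
apply: IH => //; last by rewrite -ltnS ltn_neqAle ne.
apply: (mulfI b0); rewrite mulr0 -[RHS]E mulr_sumr.
apply: eq_bigr => l _; rewrite [in RHS]big_ord_recr /= (bform_eq0 top) //.
rewrite scale0r addr0 mulrCA; congr (_ * _); rewrite mulr_sumr.
by apply: eq_bigr => q _; rewrite -scalerAr mulrCA -exprS subSn // -ltnS.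
Qed.

(** A form of degree [n] has [n + 1] coefficients, so the coefficient matrix of
    the [v i] is square, hence invertible. *)
Lemma indep_forms_span n (v : 'I_n.+1 -> {mpoly K[2]}) f :
  (forall i, v i \is n.-homog) ->
  (forall x : 'I_n.+1 -> K, \sum_i x i *: v i = 0 -> forall i, x i = 0) ->
  f \is n.-homog -> exists x : 'I_n.+1 -> K, f = \sum_i x i *: v i.
Proof.
move=> vh ind fh.
pose A := \matrix_(i < n.+1, j < n.+1) (v i)@_(mon2 j (n - j)).
have sumA (x : 'rV[K]_n.+1) : \sum_i x 0 i *: v i =
    bform n.+1 (fun j => if insub j is Some j' then (x *m A) 0 j' else 0).
  rewrite [LHS](homog_bform (n := n)); last first.
    by apply: rpred_sum => i _; apply: rpredZ; exact: vh.
  apply: eq_bigr => j _; congr (_ *: _); rewrite valK mxE raddf_sum.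
  by apply: eq_bigr => i _; rewrite /= mcoeffZ mxE.
have freeA : row_free A.
  rewrite -kermx_eq0; apply/eqP/row_matrixP => i; rewrite row0.
  have : row i (kermx A) *m A = 0 by rewrite -row_mul mulmx_ker row0.
  set x := row i _ => xA; apply/rowP => j; rewrite [RHS]mxE.
  apply: (ind (fun j => x 0 j)); rewrite sumA xA /bform big1 // => l _.
  by rewrite valK mxE scale0r.
have uA : A \in unitmx by rewrite -row_free_unit.
pose y := (\row_j f@_(mon2 j (n - j)) *m invmx A : 'rV[K]_n.+1).
exists (fun i => y 0 i); rewrite sumA mulmxKV // {1}(homog_bform fh).
by apply: eq_bigr => j _; rewrite valK mxE.
Qed.

End BinaryForms.

(** * A pencil of binary quadrics *)

Section Pencil.
Variables (K : fieldType) (p0 p1 : {mpoly K[2]}).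
Hypotheses (p0_homog : p0 \is 2.-homog) (p1_homog : p1 \is 2.-homog).
Hypothesis p_coprime : rel_prime p0 p1.
Implicit Types (f g l A B C : {mpoly K[2]}).

Lemma not_unit_homog n f : f \is n.+1.-homog -> f \isn't a GRing.unit.
Proof.
move=> fh; have [->|nz] := eqVneq f 0; first by rewrite unitr0.
by rewrite mpoly_unitE (msize_homog fh nz).
Qed.

Lemma pencil_neq0 : p0 != 0.
Proof.
apply/eqP => p00; have := not_unit_homog p1_homog.
rewrite (p_coprime (g := p1)) //; last exact: divides_refl.
by rewrite p00; exists 0; rewrite mulr0.
Qed.

(** The form [p0] would divide [l2 * p1], hence [l2], whose degree is too small. *)
Lemma pencil_no_linear_syzygy l1 l2 : (msize l2 <= 2)%N ->
  l1 * p0 + l2 * p1 = 0 -> l1 = 0 /\ l2 = 0.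
Proof.
move=> sl E; have l20 : l2 = 0.
  apply/eqP; apply: contraTT sl => nz; rewrite -ltnNge.
  rewrite -[X in (X <= _)%N](msize_homog p0_homog pencil_neq0).
  apply: divides_msize nz.
  apply: (rel_prime_divides (@mpoly_factorial _ _) pencil_neq0 p_coprime).
  exists (- l1); apply/eqP; rewrite mulrN -addr_eq0 -[X in _ == X]E.
  by rewrite addrC mulrC [p1 * _]mulrC.
split=> //; move/eqP: E; rewrite l20 mul0r addr0 mulf_eq0.
by rewrite (negbTE pencil_neq0) orbF => /eqP.
Qed.

Lemma bform2E (c : nat -> K) : bform 2 c = c 0%N *: 'X_ord_max + c 1%N *: 'X_ord0.
Proof.
by rewrite /bform !big_ord_recl big_ord0 addr0 !mpolyX_mon2 /= expr0 expr1 mulr1 mul1r.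
Qed.

(** The products of [p0] and [p1] with the two variables are four cubics, and they
    are independent for want of a linear syzygy. *)
Lemma pencil_cubics f : f \is 3.-homog -> exists A B,
  [/\ A \is 1.-homog, B \is 1.-homog & f = p0 * A + p1 * B].
Proof.
move=> fh.
pose v (i : 'I_4) : {mpoly K[2]} :=
  [:: 'X_ord_max * p0; 'X_ord0 * p0; 'X_ord_max * p1; 'X_ord0 * p1]`_i.
have lin (x : 'I_4 -> K) : \sum_i x i *: v i =
    bform 2 (fun j => x (inord j)) * p0 + bform 2 (fun j => x (inord (2 + j))) * p1.
  rewrite !big_ord_recl big_ord0 addr0 /v /= !bform2E !mulrDl -!scalerAl !addrA.
  by congr (x _ *: _ + x _ *: _ + x _ *: _ + x _ *: _); apply: val_inj; rewrite /= ?inordK.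
have Xh (i : 'I_2) : ('X_i : {mpoly K[2]}) \is 1.-homog by rewrite dhomogX /= mdeg1.
have [||x fE] := @indep_forms_span K 3 v f _ _ fh.
- by case=> [[|[|[|[|//]]]] lt] /=; rewrite -[3%N]/(1 + 2)%N; apply: dhomogM.
- move=> x; rewrite lin => /pencil_no_linear_syzygy [|b1 b2].
    exact: bform_msize.
  move=> i; have [lti|gei] := ltnP i 2.
    by rewrite -(bform_eq0 b1 lti); congr x; apply: val_inj; rewrite /= inordK.
  rewrite -(bform_eq0 (i := i - 2) b2); last by rewrite ltn_subLR.
  by congr x; apply: val_inj; rewrite /= inordK subnKC.
exists (bform 2 (fun j => x (inord j))), (bform 2 (fun j => x (inord (2 + j)))).
split; try exact: bform_homog.
by rewrite fE lin mulrC [p1 * _]mulrC.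
Qed.

(** Each monomial of degree at least 3 is a multiple of one of degree exactly 3,
    so that the multipliers lose no more than the degree of [p0] and [p1]. *)
Lemma pencil_ord_ge3 n f : (3 <= n)%N -> ord_ge n f -> exists A B,
  [/\ ord_ge (n - 2) A, ord_ge (n - 2) B & f = p0 * A + p1 * B].
Proof.
move=> n3 fo; rewrite [f]mpolyE big_seq.
apply: (big_ind (fun g => exists A B,
  [/\ ord_ge (n - 2) A, ord_ge (n - 2) B & g = p0 * A + p1 * B])).
- by exists 0, 0; rewrite !mulr0 addr0; split=> //; exact: ord_ge_zero.
- move=> g1 g2 [A1 [B1 [oA1 oB1 ->]]] [A2 [B2 [oA2 oB2 ->]]].
  exists (A1 + A2), (B1 + B2); split; try exact: ord_geD.
  by ring.
move=> m; rewrite mcoeff_msupp => /fo le_m.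
(* A divisor of degree 3 of the monomial: take as much of [T0] as possible. *)
pose i := minn (m ord0) 3.
have dm := mdeg2 m.
have [A [B [Ah Bh E]]] : exists A B, [/\ A \is 1.-homog, B \is 1.-homog
    & 'X_[mon2 i (3 - i)] = p0 * A + p1 * B].
  by apply: pencil_cubics; rewrite dhomogX /= mdeg_mon2 subnKC // geq_minr.
have mE : m = (mon2 i (3 - i) + mon2 (m ord0 - i) (m ord_max - (3 - i)))%MM.
  rewrite [LHS]mon2K; apply/mnmP => j; rewrite mnmDE.
  have [->|->] : j = ord0 \/ j = ord_max.
  - by case: j => [[|[|//]] lt]; [left|right]; apply: val_inj.
  - by rewrite !mon2_0 /i; lia.
  - by rewrite !mon2_1 /i; move: dm le_m n3; lia.
set m' := mon2 (m ord0 - i) _ in mE.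
have om' C : C \is 1.-homog -> ord_ge (n - 2) (f@_m *: (C * 'X_[m'])).
  move=> /ord_ge_homog oC; rewrite scalerAl.
  apply: (@ord_geW _ _ (1 + mdeg m')).
    by rewrite /m' mdeg_mon2 /i; move: dm le_m n3; lia.
  apply: ord_geM; last by apply: ord_ge_homog; rewrite dhomogX.
  by rewrite -mul_mpolyC mulrC; apply: ord_geMl.
exists (f@_m *: (A * 'X_[m'])), (f@_m *: (B * 'X_[m'])); split; try exact: om'.
by rewrite -!scalerAr -scalerDr mE mpolyXD E; congr (_ *: _); ring.
Qed.

Variables g0 h0 g1 h1 : {mpoly K[2]}.
Hypotheses (g0_homog : g0 \is 1.-homog) (h0_homog : h0 \is 1.-homog).
Hypotheses (g1_homog : g1 \is 1.-homog) (h1_homog : h1 \is 1.-homog).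
Hypothesis p0E : p0 = 'X_ord0 * g0 + 'X_ord_max * h0.
Hypothesis p1E : p1 = 'X_ord0 * g1 + 'X_ord_max * h1.

(** The determinant of the system expressing [p0] and [p1] through the variables:
    [T0 * q = h1 * p0 - h0 * p1] and [T1 * q = g0 * p1 - g1 * p0]. *)
Definition sylvester_form := h1 * g0 - h0 * g1.
Local Notation q := sylvester_form.

Lemma sylvester_form_homog : q \is 2.-homog.
Proof. by apply: rpredB; rewrite -[2%N]/(1 + 1)%N; apply: dhomogM. Qed.

(** [q] generates the socle of [K[T] / (p0, p1)]: a relation would turn the
    identity [T0 * q = h1 * p0 - h0 * p1] into a linear syzygy, forcing [T0] to
    divide both [p0] and [p1]. *)
Lemma sylvester_form_notin (al be : K) : q <> al *: p0 + be *: p1.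
Proof.
move=> E.
have Xh : ('X_ord0 : {mpoly K[2]}) \is 1.-homog by rewrite dhomogX /= mdeg1.
have [||h1E /eqP h0E] := @pencil_no_linear_syzygy
    (h1 - al *: 'X_ord0) (- h0 - be *: 'X_ord0).
- have hh : - h0 - be *: 'X_ord0 \is 1.-homog.
    by apply: rpredB; [rewrite rpredN | apply: rpredZ].
  have [->|nz] := eqVneq (- h0 - be *: 'X_ord0) 0; first by rewrite msize0.
  by rewrite (msize_homog hh nz).
- have Eq : 'X_ord0 * q = h1 * p0 - h0 * p1 by rewrite /q p0E p1E; ring.
  rewrite -[X in _ = X](subrr ('X_ord0 * q)) {1}Eq E -!mul_mpolyC; ring.
have := not_unit_homog Xh; rewrite p_coprime //.
  exists (g0 - be *: 'X_ord_max); rewrite p0E.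
  move: h0E; rewrite subr_eq0 eqr_oppLR => /eqP ->.
  by rewrite -!mul_mpolyC; ring.
exists (g1 + al *: 'X_ord_max); rewrite p1E (subr0_eq h1E).
by rewrite -!mul_mpolyC; ring.
Qed.

(** A relation between [p0], [p1] and [q] either expresses [q] through [p0] and
    [p1] or is a syzygy with constant coefficients. *)
Lemma pencil_quadrics f : f \is 2.-homog -> exists al be ka : K,
  f = al *: p0 + be *: p1 + ka *: q.
Proof.
move=> fh; pose v (i : 'I_3) : {mpoly K[2]} := [:: p0; p1; q]`_i.
have lin (x : 'I_3 -> K) : \sum_i x i *: v i =
    x ord0 *: p0 + x i31 *: p1 + x ord_max *: q.
  rewrite !big_ord_recl big_ord0 addr0 /v /= !addrA.
  by congr (_ + x _ *: _ + x _ *: _); apply: val_inj.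
have [||x fE] := @indep_forms_span K 2 v f _ _ fh; last 1 first.
- by exists (x ord0), (x i31), (x ord_max); rewrite fE lin.
- by case=> [[|[|[|//]]] lt] //=; exact: sylvester_form_homog.
move=> x; rewrite lin => E.
have x2 : x ord_max = 0.
  apply/eqP; apply/negP => /negP nz.
  apply: (@sylvester_form_notin (- (x ord0 / x ord_max)) (- (x i31 / x ord_max))).
  apply: (scalerI nz); apply/eqP; rewrite -subr_eq0 -[X in _ == X]E; apply/eqP.
  rewrite [X in _ - X]scalerDr !scalerA !mulrN !(mulrC (x ord_max)) !divfK // !scaleNr.
  by rewrite opprD !opprK addrC.
rewrite x2 scale0r addr0 in E.
have [||a0 b0] := @pencil_no_linear_syzygy (x ord0)%:MP (x i31)%:MP.
- by rewrite msizeC; case: eqP.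
- by rewrite !mul_mpolyC.
case=> [[|[|[|//]]] lt].
- rewrite (_ : Ordinal lt = ord0); last exact: val_inj.
  by move/eqP: a0; rewrite mpolyC_eq0 => /eqP.
- rewrite (_ : Ordinal lt = i31); last exact: val_inj.
  by move/eqP: b0; rewrite mpolyC_eq0 => /eqP.
by rewrite (_ : Ordinal lt = ord_max) //; exact: val_inj.
Qed.

Lemma pencil_ord_ge2 f : ord_ge 2 f -> exists A B C,
  f = p0 * A + p1 * B + q * C.
Proof.
move=> fo; have [|A [B [_ _ E]]] := @pencil_ord_ge3 3 (f - pihomog mdeg 2 f) isT.
  apply/ord_geP => j lt; rewrite raddfB /=.
  have [->|ne] := eqVneq j 2; first by rewrite pihomog_id subrr.
  rewrite [X in _ - X](pihomog_ne0 (d := 2)) ?pihomogP 1?eq_sym // subr0.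
  by have /ord_geP := fo; apply; rewrite ltn_neqAle ne -ltnS.
have [al [be [ka E2]]] := pencil_quadrics (pihomogP mdeg 2 f).
exists (A + al%:MP), (B + be%:MP), ka%:MP.
move/eqP: E; rewrite subr_eq E2 -!mul_mpolyC => /eqP ->; ring.
Qed.

End Pencil.

(** * Evaluation, substitution and linear dependence *)

Section Evaluation.
Variable K : closedFieldType.

Lemma meval_muni n (f : {mpoly K[n.+1]}) (x : 'I_n.+1 -> K) :
  f.@[x] = (map_poly (meval (fun i => x (widen_ord (leqnSn n) i))) (muni f)).[x ord_max].
Proof.
elim/mpolyind: f => [|a m p _ _ IH]; first by rewrite !raddf0 horner0.
rewrite mevalD.
rewrite muniD.
rewrite [in RHS]raddfD.
rewrite hornerD /=.
rewrite -[X in _ = _ + X]IH.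
congr (_ + _).
rewrite mevalZ mevalX muniZ muniX scalerA map_polyZ /= map_polyXn hornerZ hornerXn.
rewrite mevalM mevalC mevalX -mulrA big_ord_recr /=; congr (_ * (_ * _)).
by apply: eq_bigr => i _; rewrite mnmE.
Qed.

(** An algebraically closed field is infinite: each nonzero coefficient of [muni f]
    is nonzero somewhere, and then a nonzero univariate polynomial remains. *)
Lemma meval_eq0 n (f : {mpoly K[n]}) : (forall x, f.@[x] = 0) -> f = 0.
Proof.
elim: n f => [|n IH] f f0.
  have := f0 (fun=> 0); rewrite (nvar0_mpolyC f) mevalC => ->.
  exact: mpolyC0.
apply: (@muni_inj n K); rewrite muni0; apply/polyP => i; rewrite coef0.
apply: IH => x; apply/eqP; apply: contraT => nz.
have /closed_nonrootP [y] : map_poly (meval x) (muni f) != 0.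
  apply: contra nz => /eqP /(congr1 (fun p : {poly K} => p`_i)).
  by rewrite coef_map coef0 => ->.
rewrite /root -[_.[y]](_ : f.@[fun i => if unlift ord_max i is Some j then x j else y] = _).
  by rewrite f0 eqxx.
rewrite meval_muni unlift_none; congr _.[_]; apply: eq_map_poly => c.
apply: meval_eq => j; rewrite (_ : widen_ord _ j = lift ord_max j) ?liftK //.
by apply: val_inj; rewrite /= /bump leqNgt ltn_ord.
Qed.

Lemma meval_scale n d (f : {mpoly K[n]}) c (x y : 'I_n -> K) : f \is d.-homog ->
  (forall i, x i = c * y i) -> f.@[x] = c ^+ d * f.@[y].
Proof.
move=> /dhomogP fh xE; rewrite !mevalE mulr_sumr big_seq [RHS]big_seq.
apply: eq_bigr => m /fh <-; rewrite mulrCA; congr (_ * _).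
under eq_bigr do rewrite xE exprMn.
by rewrite big_split /= prodrXr -mdegE.
Qed.

End Evaluation.

Section Substitution.
Variables (K : fieldType) (n d : nat).
Variable (u : 'I_n -> {mpoly K[2]}).
Hypothesis u_homog : forall i, u i \is d.-homog.

Definition subst (f : {mpoly K[n]}) : {mpoly K[2]} := mmap (@mpolyC 2 K) u f.

Lemma substX m : subst 'X_[m] = \prod_i u i ^+ m i.
Proof. by rewrite /subst mmapX. Qed.

Lemma substX_homog m : subst 'X_[m] \is (d * mdeg m).-homog.
Proof.
rewrite substX mdegE big_distrr /=.
elim/big_rec2: _ => [|i a b _ IH]; first exact: dhomog1.
by apply: dhomogM => //; apply: dhomogMn.
Qed.

Lemma substZ c f : subst (c *: f) = c *: subst f.
Proof. by rewrite /subst mmapZ mul_mpolyC. Qed.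

Lemma pihomog_subst r f : (0 < d)%N ->
  pihomog mdeg (d * r) (subst f) = subst (pihomog mdeg r f).
Proof.
move=> d0; elim/mpolyind: f => [|c m f _ _ IH].
  by rewrite /subst !raddf0.
have sD f1 f2 : subst (f1 + f2) = subst f1 + subst f2 by exact: raddfD.
rewrite sD !raddfD /= sD IH; congr (_ + _).
rewrite substZ !linearZ /= substZ pihomogX; congr (_ *: _).
case: eqVneq => [<-|ne]; first by rewrite pihomog_dE ?substX_homog.
rewrite (pihomog_ne0 _ (substX_homog m)); last by rewrite eqn_pmul2l.
by rewrite /subst mmap0.
Qed.

Lemma meval_subst f (t : 'I_2 -> K) : (subst f).@[t] = f.@[fun i => (u i).@[t]].
Proof.
elim/mpolyind: f => [|c m f _ _ IH]; first by rewrite /subst !raddf0.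
have sD f1 f2 : subst (f1 + f2) = subst f1 + subst f2 by exact: raddfD.
rewrite sD !mevalD IH substZ !mevalZ substX rmorph_prod mevalX.
by congr (_ * _ + _); apply: eq_bigr => i _; rewrite rmorphXn.
Qed.

End Substitution.

Section LinearDependence.
Variable R : idomainType.

(** The coefficients form a square matrix whose last column is zero. *)
Lemma polys_dependent e (r : 'I_e -> {poly R}) :
  (forall i, (size (r i) < e)%N) ->
  (0 < e)%N -> exists2 x : 'I_e -> R, exists i, x i != 0 & \sum_i x i *: r i = 0.
Proof.
move=> sr e0; pose A := \matrix_(i < e, j < e) (r i)`_j.
have lt : (e.-1 < e)%N by rewrite prednK.
have /det0P [v v0 vA] : \det A == 0.
  rewrite -det_tr; apply/det0P; exists (delta_mx 0 (Ordinal lt)).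
    apply/eqP => /matrixP /(_ 0 (Ordinal lt)) /eqP.
    by rewrite !mxE !eqxx oner_eq0.
  rewrite -rowE; apply/rowP => j; rewrite !mxE /=; apply: nth_default.
  by rewrite -ltnS prednK.
exists (v 0); first by have /rV0Pn := v0.
apply/polyP => j; rewrite coef0 coef_sum; under eq_bigr do rewrite coefZ.
have [ltj|gej] := ltnP j e.
  have /matrixP /(_ 0 (Ordinal ltj)) := vA; rewrite !mxE => vAj.
  by rewrite -[RHS]vAj; apply: eq_bigr => i _; rewrite mxE.
rewrite big1 // => i _; rewrite nth_default ?mulr0 //.
by apply: leq_trans gej; apply: ltnW.
Qed.

End LinearDependence.

(** * The inverse of a proper parametrization *)

Lemma variables_rel_prime (K : fieldType) :
  rel_prime ('X_ord0 : {mpoly K[2]}) 'X_ord_max.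
Proof.
move=> r r0 r1; apply/negPn/negP => ru.
have deg1 i : divides r 'X_i -> exists a : K, 'X_i = a *: r.
  move=> [s sE].
  have X0 : 'X_i != 0 :> {mpoly K[2]} by rewrite -msize_poly_eq0 msizeX.
  have := X0; rewrite sE mulf_eq0 negb_or => /andP [rn sn].
  have := msizeM rn sn; rewrite -sE msizeX mdeg1 => sz.
  move: ru; rewrite mpoly_unitE => ru.
  have small a b : 2 = (a + b).-1 -> a != 0 -> b != 0 -> a != 1 -> (b <= 1)%N by lia.
  have s1 : (msize s <= 1)%N.
    by apply: small sz _ _ ru; rewrite msize_poly_eq0.
  by exists s@_0; rewrite sE {1}(msize1_polyC s1) mulrC mul_mpolyC.
have [a aE] := deg1 _ r0; have [b bE] := deg1 _ r1.
have coef (i j : 'I_2) x : 'X_i = x *: r -> (i == j)%:R = x * r@_U_(j).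
  by move=> /(congr1 (mcoeff U_(j))); rewrite mcoeffZ mcoeffXU.
have : (1 : K) = (a * r@_U_(ord0)) * (b * r@_U_(ord_max)).
  by rewrite -(coef _ _ _ aE) -(coef _ _ _ bE) !eqxx mulr1.
rewrite mulrACA [r@__ * _]mulrC -mulrACA -(coef _ _ _ aE) mul0r => /eqP.
by rewrite oner_eq0.
Qed.

Section Multiplicity.
Variable K : closedFieldType.
Variable u : 'I_3 -> {mpoly K[2]}.

(** Parameters where [t] or [u t] vanishes do not give a point of the curve; there
    homogeneity takes over. *)
Lemma curve_equation_vanish d (E : {mpoly K[3]}) : (0 < d)%N ->
  (forall i, u i \is d.-homog) -> E \is d.-homog -> defines_curve u E -> subst u E = 0.
Proof.
move=> d_gt0 u_homog Eh Ec; apply: meval_eq0 => t; rewrite meval_subst.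
set p := fun i => _.
have zero n (f : {mpoly K[n]}) (x : 'I_n -> K) :
    f \is d.-homog -> (forall i, x i = 0) -> f.@[x] = 0.
  move=> fh x0; rewrite (meval_scale (c := 0) (y := x) fh) ?expr0n ?gtn_eqF ?mul0r //.
  by move=> i; rewrite x0 mul0r.
have [nz_p|z_p] := classic (nonzero_vec p); last first.
  apply: zero => // i; apply: NNPP => nz; apply: z_p; exists i; exact/eqP.
apply/(Ec p nz_p); exists t; split; last first.
  by exists 1; [exact: oner_neq0 | move=> i; rewrite mul1r].
apply: NNPP => z_t; case: nz_p => i; rewrite /p zero ?eqxx // => j.
by apply: NNPP => nz; apply: z_t; exists j; apply/eqP.
Qed.

(** The rational inverse of the parametrization, pulled back along it, is
    [(T0 : T1)] up to a common factor [g]. *)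
Lemma proper_inverse : proper_param u ->
  exists (v : 'I_2 -> {mpoly K[3]}) (g : {mpoly K[2]}),
    g != 0 /\ forall i, subst u (v i) = 'X_i * g.
Proof.
move=> [e [v [vh [p [[t [tz [c c0 pE]]] vp]] vu _]]].
have swap : 'X_ord_max * subst u (v ord0) = 'X_ord0 * subst u (v ord_max).
  apply/eqP; rewrite -subr_eq0; apply/eqP; apply: meval_eq0 => x.
  rewrite mevalB 2!mevalM 2!mevalXU 2!meval_subst.
  set y := fun i => _; apply/eqP; rewrite subr_eq0; apply/eqP.
  have [z_v|nz_v] := classic (forall i, (v i).@[y] = 0).
    by rewrite !z_v !mulr0.
  have nzv : nonzero_vec (eval_all v y).
    apply: NNPP => h; apply: nz_v => i; apply: NNPP => ne; apply: h.
    by exists i; apply/eqP.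
  have [nzx|zx] := classic (nonzero_vec x); last first.
    have x0 i : x i = 0 by apply: NNPP => ne; apply: zx; exists i; apply/eqP.
    by rewrite !x0 !mul0r.
  have [a a0 aE] := vu x nzx nzv.
  have := aE ord0; have := aE ord_max; rewrite /eval_all -/y => -> ->.
  by ring.
have [g gE] : divides 'X_ord0 (subst u (v ord0)).
  apply: (rel_prime_divides (b := 'X_ord_max) (@mpoly_factorial K 2)).
  - by rewrite -msize_poly_eq0 msizeX.
  - exact: variables_rel_prime.
  by exists (subst u (v ord_max)).
exists v, g; have w1 : subst u (v ord_max) = 'X_ord_max * g.
  apply: (@mulfI _ 'X_ord0); first by rewrite -msize_poly_eq0 msizeX.
  by rewrite -swap gE; ring.
split; last first.
  move=> i; have [->|->] : i = ord0 \/ i = ord_max => //.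
  by case: i => [[|[|//]] lt]; [left|right]; apply: val_inj.
apply/eqP => g0; case: vp => i; rewrite /eval_all (meval_scale (vh i) pE).
have : (subst u (v i)).@[t] = 0.
  have [->|->] : i = ord0 \/ i = ord_max.
    by case: i => [[|[|//]] lt]; [left|right]; apply: val_inj.
  by rewrite gE g0 mulr0 meval0.
  by rewrite w1 g0 mulr0 meval0.
by rewrite meval_subst => ->; rewrite mulr0 eqxx.
Qed.

End Multiplicity.

(** * Multiplicity and the degree of the projection from (0 : 0 : 1) *)

Section Mult.
Variable K : closedFieldType.

Lemma order_at0_le n (f : {mpoly K[n]}) m : f@_m != 0 -> (order_at0 f <= mdeg m)%N.
Proof.
rewrite -mcoeff_msupp /order_at0; elim: (msupp f) => // a s IH.
rewrite inE big_cons => /orP [/eqP ->|/IH]; rewrite geq_min ?leqnn // => ->.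
by rewrite orbT.
Qed.

Definition affine_part (m : 'X_{1..3}) : 'X_{1..3} :=
  [multinom if i == ord_max then 0%N else m i | i < 3].

Lemma mdeg_affine_part m : mdeg m = (mdeg (affine_part m) + m ord_max)%N.
Proof.
by rewrite !mdegE !big_ord_recr !big_ord0 /= !mnmE /= addn0.
Qed.

(** In the chart [X2 = 1] a form only loses its powers of [X2]; this does not
    merge monomials since the total degree is fixed. *)
Lemma mult_point001 d (E : {mpoly K[3]}) m : E \is d.-homog -> E@_m != 0 ->
  (mult E (point001 K) + m ord_max <= d)%N.
Proof.
move=> Eh nz; have dm : mdeg m = d.
  by apply: (dhomog_mf Eh); rewrite mcoeff_msupp.
rewrite -dm mdeg_affine_part leq_add2r /mult.
case: pickP => [i|none]; last first.
  by have := none ord_max; rewrite /point001 eqxx oner_eq0.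
rewrite /point001; have [-> _|ne] := eqVneq i ord_max; last by rewrite eqxx.
apply: order_at0_le; rewrite /local_equation.
set lq := [tuple _ | j < 3].
have lqE (j : 'I_3) : tnth lq j = if j == ord_max then 1 else 'X_j.
  rewrite tnth_mktuple eqxx divr1; case: eqVneq => _; first by rewrite addr0 mpolyC1.
  by rewrite mpolyC0 add0r.
have X_lq m' : 'X_[m'] \mPo lq = 'X_[affine_part m'] :> {mpoly K[3]}.
  rewrite comp_mpolyX [RHS]mpolyXE_id; apply: eq_bigr => j _.
  by rewrite lqE mnmE; case: eqP; rewrite ?expr1n ?expr0.
have -> : (E \mPo lq)@_(affine_part m) = E@_m; last by [].
rewrite comp_mpolyEX raddf_sum /=.
have mE : m \in msupp E by rewrite mcoeff_msupp.
rewrite (bigD1_seq m) ?msupp_uniq //= X_lq mcoeffZ mcoeffX eqxx mulr1.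
rewrite big_seq_cond big1 ?addr0 // => m' /andP [m'E ne].
rewrite X_lq mcoeffZ mcoeffX; case: eqP => [eqa|]; last by rewrite mulr0.
case/eqP: ne; apply/mnmP => j.
have dm' : mdeg m' = mdeg m by rewrite dm; apply: (dhomog_mf Eh).
have [->|jn] := eqVneq j ord_max.
  move: dm'; rewrite (mdeg_affine_part m) mdeg_affine_part eqa.
  by move/addnI.
have := congr1 (fun m0 : 'X_{1..3} => m0 j) eqa.
by rewrite !mnmE (negbTE jn).
Qed.

End Mult.

Section SubstMore.
Variables (K : fieldType) (u : 'I_3 -> {mpoly K[2]}).

(** The projection of the parametrization from [(0 : 0 : 1)]. *)
Definition u01 (i : 'I_2) : {mpoly K[2]} := u (widen_ord (leqnSn 2) i).

Lemma subst_mwiden (f : {mpoly K[2]}) : subst u (mwiden f) = subst u01 f.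
Proof.
elim/mpolyind: f => [|c m f _ _ IH]; first by rewrite mwiden0 /subst !raddf0.
have sD n (w : 'I_n -> {mpoly K[2]}) f1 f2 : subst w (f1 + f2) = subst w f1 + subst w f2.
  exact: raddfD.
rewrite mwidenD !sD IH mwidenZ !substZ mwidenX !substX; congr (_ *: _ + _).
rewrite big_ord_recr /= mnmwiden_ordmax expr0 mulr1.
by apply: eq_bigr => i _; rewrite mnmwiden_widen.
Qed.

Lemma substM n (w : 'I_n -> {mpoly K[2]}) f g :
  subst w (f * g) = subst w f * subst w g.
Proof. exact: rmorphM. Qed.

Lemma subst_sum n (w : 'I_n -> {mpoly K[2]}) I (r : seq I) P (F : I -> {mpoly K[n]}) :
  subst w (\sum_(i <- r | P i) F i) = \sum_(i <- r | P i) subst w (F i).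
Proof. exact: raddf_sum. Qed.

Lemma subst_bform (w : 'I_2 -> {mpoly K[2]}) r c :
  subst w (bform r.+1 c) = \sum_(j < r.+1) c j *: (w ord0 ^+ j * w ord_max ^+ (r - j)).
Proof.
rewrite /bform subst_sum; apply: eq_bigr => j _; rewrite substZ substX.
rewrite !big_ord_recl big_ord0 mulr1 mon2_0 (_ : lift _ _ = ord_max) ?mon2_1 //.
exact: val_inj.
Qed.

End SubstMore.

Section DegreeBound.
Variable K : closedFieldType.
Variables (d : nat) (u : 'I_3 -> {mpoly K[2]}).
Hypotheses (d_gt0 : (0 < d)%N) (u_homog : forall i, u i \is d.-homog).

(** [e] is the degree of the projection [(a : b)] of the parametrization from
    [(0 : 0 : 1)]. Since [T0 / T1] is a rational function of the [u_i], the [e]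
    independent monomials of degree [e - 1] are, up to a common factor, values
    at [u] of forms in [X]; reducing these modulo [E], of degree less than [e]
    in [X2], would make them dependent over [K[X0, X1]]. *)
Lemma projection_degree_lt (E : {mpoly K[3]}) h a b e :
  proper_param u -> u ord0 = h * a -> u i31 = h * b -> h != 0 ->
  rel_prime a b -> (e < msize b)%N -> E != 0 -> subst u E = 0 ->
  (e < size (muni E))%N.
Proof.
move=> prop u0E u1E h0 co ltb E0 Eu; rewrite ltnNge; apply/negP => sE.
have [v [g [g0 vE]]] := proper_inverse prop.
have mE0 : muni E != 0.
  by apply: contra E0 => /eqP mE; apply/eqP; apply: muni_inj; rewrite mE muni0.
have e0 : (0 < e)%N by apply: leq_trans sE; rewrite size_poly_gt0.
pose V (i : 'I_e) := v ord0 ^+ i * v ord_max ^+ (e.-1 - i).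
have VE i : subst u (V i) = 'X_[mon2 i (e.-1 - i)] * g ^+ e.-1.
  have le_i : (i <= e.-1)%N by rewrite -ltnS prednK.
  rewrite substM (_ : subst u (v ord0 ^+ i) = subst u (v ord0) ^+ i); last exact: rmorphXn.
  rewrite (_ : subst u (v ord_max ^+ _) = subst u (v ord_max) ^+ (e.-1 - i)).
    by rewrite !vE !exprMn mulrACA -exprD subnKC // mpolyX_mon2.
  exact: rmorphXn.
(* The [e] remainders modulo [E] have fewer than [e] coefficients. *)
have [||x [i0 xi0] xr] := @polys_dependent _ e (fun i => muni (V i) %% muni E).
- by move=> i; apply: leq_trans sE; rewrite ltn_modp.
- by [].
pose mu i := x i * lead_coef (muni E) ^+ scalp (muni (V i)) (muni E).
have mui0 : mu i0 != 0 by rewrite mulf_neq0 ?expf_neq0 ?lead_coef_eq0.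
have [q qE] : exists q, \sum_i mwiden (mu i) * V i = q * E.
  exists (muni_inv (\sum_i x i *: (muni (V i) %/ muni E))); apply: muni_inj.
  rewrite muniM muni_invK raddf_sum /= mulr_suml.
  rewrite -[RHS]addr0 -[X in _ = _ + X]xr -big_split /=.
  apply: eq_bigr => i _; rewrite muniM muni_mwiden mul_polyC -scalerA.
  by rewrite Pdiv.Idomain.divp_eq scalerDr scalerAl.
have sum0 : \sum_(i < e) 'X_[mon2 i (e.-1 - i)] * subst (u01 u) (mu i) = 0.
  apply: (@mulIf _ (g ^+ e.-1)); first by rewrite expf_neq0.
  have S : subst u (\sum_i mwiden (mu i) * V i) = 0 by rewrite qE substM Eu mulr0.
  rewrite mul0r mulr_suml; apply: etrans S; rewrite subst_sum; apply: eq_bigr => i _.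
  by rewrite [subst u (_ * V i)]substM VE subst_mwiden; ring.
(* The degrees in [T] of the [u_i] separate the degrees [r] of the coefficients. *)
have coef0 r : forall i j, (i < e)%N -> (j <= r)%N ->
    (if insub i is Some i' then (mu i')@_(mon2 j (r - j)) else 0) = 0.
  apply: (monomials_indep co ltb).
  apply: (@mulfI _ (h ^+ r)); first by rewrite expf_neq0.
  have S := congr1 (pihomog mdeg (e.-1 + d * r)) sum0; rewrite pihomog0 in S.
  rewrite mulr0 mulr_sumr; apply: etrans S; rewrite raddf_sum /=; apply: eq_bigr => i _.
  rewrite (pihomogMl _ _ (e := e.-1)); last first.
    by rewrite dhomogX /= mdeg_mon2 subnKC // -ltnS prednK.
  rewrite pihomog_subst //; last by move=> j; apply: u_homog.
  rewrite mulrCA; congr (_ * _); rewrite (homog_bform (pihomogP mdeg r (mu i))).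
  rewrite subst_bform mulr_sumr; apply: eq_bigr => j _.
  have le_j : (j <= r)%N by rewrite -ltnS.
  rewrite mcoeff_pihomog mdeg_mon2 subnKC // eqxx valK /u01.
  rewrite (_ : widen_ord _ ord0 = ord0); last exact: val_inj.
  rewrite (_ : widen_ord _ ord_max = i31); last exact: val_inj.
  rewrite u0E u1E !exprMn mulrACA -exprD subnKC //.
  by rewrite -scalerAr.
case/eqP: mui0; apply/mpolyP => m; rewrite mcoeff0.
have := coef0 (mdeg m) i0 (m ord0); rewrite valK => <- //; last first.
  by rewrite mdeg2 leq_addr.
by rewrite mdeg2 addKn -mon2K.
Qed.

End DegreeBound.

(** * The moving line of a very singular point *)

Lemma homog1E (R : comNzRingType) n (G : {mpoly R[n]}) : G \is 1.-homog ->
  G = \sum_i G@_U_(i) *: 'X_i.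
Proof.
move=> Gh; apply/mpolyP => m; rewrite raddf_sum /=.
have [/eqP|m1] := eqVneq (mdeg m) 1; last first.
  rewrite (dhomog_nemf_coeff Gh) // big1 // => i _; rewrite mcoeffZ mcoeffX.
  have [E|] := eqVneq U_(i)%MM m; last by rewrite mulr0.
  by rewrite -E mdeg1 in m1.
move=> /mdeg1P [i /eqP ->]; rewrite (bigD1 i) //= mcoeffZ mcoeffX eqxx mulr1.
rewrite big1 ?addr0 // => j ji; rewrite mcoeffZ mcoeffX eq_mnm1 (negbTE ji) mulr0 //.
Qed.

Lemma big_ord3 (V : nmodType) (F : 'I_3 -> V) :
  \sum_i F i = F ord0 + F i31 + F ord_max.
Proof.
rewrite !big_ord_recl big_ord0 addr0 addrA.
by congr (_ + F _ + F _); apply: val_inj.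
Qed.

Lemma size_muni (R : idomainType) n (f : {mpoly R[n.+1]}) k :
  (forall m, f@_m != 0 -> (m ord_max < k)%N) -> (size (muni f) <= k)%N.
Proof.
move=> h; rewrite muniE big_seq; elim/big_ind: _ => [|p q sp sq|m].
- by rewrite size_poly0.
- by apply: leq_trans (size_polyD _ _) _; rewrite geq_max sp.
rewrite mcoeff_msupp => /h lt; rewrite -mul_polyC.
apply: leq_trans (size_polyMleq _ _) _; rewrite size_polyXn addnS /=.
by apply: leq_trans lt; rewrite -(add1n (m ord_max)) leq_add2r size_polyC_leq1.
Qed.

Section NoX2.
Variable K : closedFieldType.
Variables (d : nat) (u : 'I_3 -> {mpoly K[2]}).
Hypotheses (d_gt2 : (2 < d)%N) (u_homog : forall i, u i \is d.-homog).
Hypothesis u_coprime : no_common_factor u.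

Lemma common_divisor_unit g : divides g (u ord0) -> divides g (u i31) ->
  divides g (u ord_max) -> g \is a GRing.unit.
Proof.
move=> g0 g1 g2; apply: u_coprime => i.
have [->|[->|->]] // : i = ord0 \/ i = i31 \/ i = ord_max.
by case: i => [[|[|[|//]]] lt]; [left|right;left|right;right]; apply: val_inj.
Qed.

(** A moving line [a X0 + b X1 + c X2] of degree 2 with [c <> 0] would force
    [gcd (u0, u1)] to divide [c], so the projection from [(0 : 0 : 1)] would
    have degree at least [d - 2]. *)
Lemma very_singular_no_X2 (E : {mpoly K[3]}) a b c :
  proper_param u -> E \is d.-homog -> E != 0 -> defines_curve u E ->
  (2 < mult E (point001 K))%N -> c \is 2.-homog ->
  a * u ord0 + b * u i31 + c * u ord_max = 0 -> c = 0.
Proof.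
move=> prop Eh E0 Ec Em ch syz; apply/eqP; apply: contraT => c0.
have [h [a' [b' [u0E u1E co h0]]]] : exists h a' b',
    [/\ u ord0 = h * a', u i31 = h * b', rel_prime a' b' & h != 0].
  have [u00|u00] := eqVneq (u ord0) 0; last first.
    have [h [a' [b' [E1 E2 co]]]] := gcd_exists (u i31) (@mpoly_factorial K 2) u00.
    exists h, a', b'; split=> //; apply: contraNneq u00 => h0.
    by rewrite E1 h0 mul0r.
  have u10 : u i31 != 0.
    apply/eqP => u10.
    have u20 : u ord_max = 0.
      apply: (mulfI c0); rewrite mulr0; apply: etrans syz.
      by rewrite u00 u10 !mulr0 !add0r.
    have : (0 : {mpoly K[2]}) \is a GRing.unit.
      by apply: common_divisor_unit; exists 0; rewrite ?u00 ?u10 ?u20 mulr0.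
    by rewrite unitr0.
  have [h [b' [a' [E1 E2 co]]]] := gcd_exists (u ord0) (@mpoly_factorial K 2) u10.
  exists h, a', b'; split=> //; first exact: rel_primeC.
  by apply: contraNneq u10 => h0; rewrite E1 h0 mul0r.
(* [h] divides [c * u2] and is prime to [u2], the [u_i] having no common factor. *)
have hc : divides h c.
  apply: (rel_prime_divides (b := u ord_max) (@mpoly_factorial K 2) h0).
    move=> g gh gu; apply: common_divisor_unit => //.
      by rewrite u0E; apply: divides_mull.
    by rewrite u1E; apply: divides_mull.
  exists (- (a * a' + b * b')).
  apply/eqP; rewrite -subr_eq0 -[X in _ == X]syz u0E u1E; apply/eqP; ring.
have sh : (msize h <= 3)%N.
  by rewrite -(msize_homog ch c0); apply: divides_msize.
have sprod x i : u i = h * x -> u i != 0 -> (d.-2 < msize x)%N.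
  move=> E1 nz; have := nz; rewrite {1}E1 mulf_eq0 negb_or => /andP [_ x0].
  have := msizeM h0 x0; rewrite -E1 (msize_homog (u_homog i) nz).
  move: sh x0; rewrite -msize_poly_eq0; move: (msize _) (msize _); lia.
have u10 : u i31 != 0.
  apply/eqP => u10; have b'0 : b' = 0.
    by apply: (mulfI h0); rewrite mulr0 -u1E.
  have : a' \is a GRing.unit.
    apply: co; first exact: divides_refl.
    by rewrite b'0; exists 0; rewrite mulr0.
  rewrite mpoly_unitE => /eqP sa.
  have : (d.-2 < 1)%N.
    rewrite -sa; apply: (sprod _ ord0) => //; rewrite u0E mulf_neq0 //.
    by rewrite -msize_poly_eq0 sa.
  lia.
have d0 : (0 < d)%N by lia.
have := projection_degree_lt d0 u_homog prop u0E u1E h0 co (sprod _ _ u1E u10)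
  E0 (curve_equation_vanish d0 u_homog Eh Ec).
rewrite ltnNge => /negP []; apply: size_muni => m /(mult_point001 Eh).
by lia.
Qed.

End NoX2.

(** * The conic bundle defined by a moving line *)

Definition mon3 (a b c : nat) : 'X_{1..3} :=
  (U_(ord0) *+ a + U_(i31) *+ b + U_(ord_max) *+ c)%MM.

Lemma ord3P (i : 'I_3) : [\/ i = ord0, i = i31 | i = ord_max].
Proof.
by case: i => [[|[|[|//]]] lt]; [constructor 1|constructor 2|constructor 3]; apply: val_inj.
Qed.

Lemma mon3_0 a b c : mon3 a b c ord0 = a.
Proof. by rewrite !mnmDE !mulmnE !mnm1E /= mul1n !mul0n !addn0. Qed.

Lemma mon3_1 a b c : mon3 a b c i31 = b.
Proof. by rewrite !mnmDE !mulmnE !mnm1E /= mul1n !mul0n add0n addn0. Qed.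

Lemma mon3_2 a b c : mon3 a b c ord_max = c.
Proof. by rewrite !mnmDE !mulmnE !mnm1E /= mul1n !mul0n !add0n. Qed.

Lemma mon3K (m : 'X_{1..3}) : m = mon3 (m ord0) (m i31) (m ord_max).
Proof. by apply/mnmP => i; case: (ord3P i) => ->; rewrite ?mon3_0 ?mon3_1 ?mon3_2. Qed.

Lemma mdeg_mon3 a b c : mdeg (mon3 a b c) = (a + b + c)%N.
Proof. by rewrite !mdegD !mdegMn !mdeg1 !mul1n. Qed.

Lemma mdeg3 (m : 'X_{1..3}) : mdeg m = (m ord0 + m i31 + m ord_max)%N.
Proof. by rewrite {1}[m]mon3K mdeg_mon3. Qed.

Lemma eq_mon3 (m : 'X_{1..3}) a b c :
  (m == mon3 a b c) = [&& m ord0 == a, m i31 == b & m ord_max == c].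
Proof.
apply/eqP/and3P => [->|[/eqP ma /eqP mb /eqP mc]].
  by rewrite mon3_0 mon3_1 mon3_2 !eqxx.
by rewrite [LHS]mon3K ma mb mc.
Qed.

Lemma big_ord3_prod (R : comNzRingType) (F : 'I_3 -> R) :
  \prod_i F i = F ord0 * F i31 * F ord_max.
Proof.
rewrite !big_ord_recl big_ord0 mulr1 mulrA.
by congr (_ * F _ * F _); apply: val_inj.
Qed.

(** The converse reading of [syzygy_powers]: coefficients [a * e l - b * e l.-1]
    belong to a multiple of [a * z - b * x]. *)
Lemma telescope_form (B : comNzRingType) (a b x z : B) (e : nat -> B) j :
  e j = 0 ->
  \sum_(l < j.+1) (a * e l - b * (if (l : nat) is l'.+1 then e l' else 0))
     * (x ^+ l * z ^+ (j - l))
  = (a * z - b * x) * \sum_(l < j) e l * (x ^+ l * z ^+ (j.-1 - l)).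
Proof.
move=> ej; rewrite mulrBl !mulr_sumr.
under eq_bigr do rewrite mulrBl; rewrite sumrB; congr (_ - _).
  rewrite big_ord_recr /= ej mulr0 mul0r addr0; apply: eq_bigr => l _.
  have le_l : (l <= j.-1)%N by case: j {ej} l => [[]|j] //= l; rewrite -ltnS.
  have -> : (j - l = (j.-1 - l).+1)%N.
    by case: j {ej} l le_l => [[]|j] //= l le_l; rewrite subSn.
  by rewrite exprS; ring.
rewrite big_ord_recl /= mulr0 mul0r add0r; apply: eq_bigr => l _.
rewrite /bump /= add1n (_ : (j - l.+1)%N = (j.-1 - l)%N); last by lia.
by rewrite exprS; ring.
Qed.

Section Conic.
Variable A : idomainType.
Hypothesis A_factorial : factorial_ring A.
Variables p0 p1 : A.
Implicit Types (G : {mpoly A[3]}) (m : 'X_{1..3}).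

Definition conic_var (i : 'I_3) : {poly {poly A}} :=
  [:: (p0 *: 'X)%:P; (p1 *: 'X)%:P; 'X]`_i.

(** The substitution [X0 = p0 s], [X1 = p1 s], [X2 = y], where [s] is the inner
    and [y] the outer variable of the target. *)
Definition conic_map G : {poly {poly A}} :=
  mmap ((@polyC {poly A}) \o (@polyC A)) conic_var G.

Lemma conic_map0 : conic_map 0 = 0. Proof. exact: mmap0. Qed.

Lemma conic_mapD G H : conic_map (G + H) = conic_map G + conic_map H.
Proof. exact: mmapD. Qed.

Lemma conic_mapB G H : conic_map (G - H) = conic_map G - conic_map H.
Proof. exact: mmapB. Qed.

Lemma conic_mapM G H : conic_map (G * H) = conic_map G * conic_map H.
Proof. exact: rmorphM. Qed.

Lemma conic_mapZ c G : conic_map (c *: G) = c%:P%:P * conic_map G.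
Proof. exact: mmapZ. Qed.

Lemma conic_mapXU i : conic_map 'X_i = conic_var i.
Proof. by rewrite /conic_map mmapX mmap1U. Qed.

Lemma conic_map_sum I (r : seq I) P (F : I -> {mpoly A[3]}) :
  conic_map (\sum_(i <- r | P i) F i) = \sum_(i <- r | P i) conic_map (F i).
Proof. exact: raddf_sum. Qed.

Lemma conic_mapX m : conic_map 'X_[m] =
  ((p0 ^+ m ord0 * p1 ^+ m i31) *: 'X^(m ord0 + m i31))%:P * 'X^(m ord_max).
Proof.
rewrite /conic_map mmapX /mmap1 big_ord3_prod /conic_var /=; congr (_ * _).
rewrite -!rmorphXn -polyCM; congr (_%:P).
by rewrite !exprZn -scalerAl -scalerAr scalerA exprD.
Qed.

Lemma coef_conic G l c : (conic_map G)`_c`_l =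
  \sum_(a < l.+1) G@_(mon3 a (l - a) c) * (p0 ^+ a * p1 ^+ (l - a)).
Proof.
elim/mpolyind: G => [|x m G _ _ IH].
  by rewrite conic_map0 !coef0 big1 // => a _; rewrite mcoeff0 mul0r.
under eq_bigr do rewrite mcoeffD mulrDl.
rewrite conic_mapD !coefD big_split /= -IH; congr (_ + _).
rewrite conic_mapZ coefCM coefCM conic_mapX coefCM coefXn.
under eq_bigr do rewrite mcoeffZ -mulrA.
rewrite -mulr_sumr; congr (_ * _).
under eq_bigr do rewrite mcoeffX eq_mon3.
have [_|nc] := eqVneq c (m ord_max); last first.
  by rewrite mulr0 coef0 big1 // => a _; rewrite !andbF mul0r.
under eq_bigr do rewrite andbT; rewrite mulr1 coefZ coefXn.
have [->|nl] := eqVneq l (m ord0 + m i31)%N.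
  have lt : (m ord0 < (m ord0 + m i31).+1)%N by rewrite ltnS leq_addr.
  rewrite (bigD1 (Ordinal lt)) //= addKn !eqxx mul1r mulr1 big1 ?addr0 // => a.
  by rewrite -val_eqE /= eq_sym => /negbTE ->; rewrite mul0r.
rewrite mulr0 big1 // => a _; case: eqP => [ma|]; last by rewrite mul0r.
case: eqP => [mb|]; last by rewrite mul0r.
case/eqP: nl; have := ltn_ord a; rewrite ma mb ltnS; lia.
Qed.

Definition moving_line : {mpoly A[3]} := p1 *: 'X_ord0 - p0 *: 'X_i31.

Definition graded_part G l c : {mpoly A[3]} :=
  \sum_(a < l.+1) G@_(mon3 a (l - a) c) *: 'X_[mon3 a (l - a) c].

Lemma graded_partE G N : (msize G <= N)%N ->
  G = \sum_(l < N) \sum_(c < N) graded_part G l c.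
Proof.
move=> sG; apply/mpolyP => m; rewrite raddf_sum /=.
have part l c : (graded_part G l c)@_m =
    if (l == m ord0 + m i31)%N && (c == m ord_max) then G@_m else 0.
  rewrite raddf_sum /=; under eq_bigr do rewrite mcoeffZ mcoeffX eq_sym eq_mon3.
  have [->|/eqP nl] := eqVneq l (m ord0 + m i31)%N; last first.
    rewrite big1 // => a _; case: eqP => [ma|]; last by rewrite mulr0.
    case: eqP => [mb|]; last by rewrite mulr0.
    by case: nl; have := ltn_ord a; rewrite ma mb ltnS; lia.
  have [->|nc] := eqVneq c (m ord_max); last first.
    by rewrite big1 // => a _; rewrite !andbF mulr0.
  have lt : (m ord0 < (m ord0 + m i31).+1)%N by rewrite ltnS leq_addr.
  rewrite (bigD1 (Ordinal lt)) //= addKn !eqxx mulr1 -mon3K big1 ?addr0 // => a.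
  by rewrite -val_eqE /= eq_sym => /negbTE ->; rewrite mulr0.
under eq_bigr do (rewrite raddf_sum /=; under eq_bigr do rewrite part).
have [z|nz] := eqVneq G@_m 0.
  by rewrite z big1 // => l _; rewrite big1 // => c _; rewrite if_same.
have lt_m : (mdeg m < N)%N.
  by apply: leq_trans sG; apply: msize_mdeg_lt; rewrite mcoeff_msupp.
rewrite mdeg3 in lt_m.
have lt_l : (m ord0 + m i31 < N)%N by apply: leq_ltn_trans lt_m; exact: leq_addr.
have lt_c : (m ord_max < N)%N by apply: leq_ltn_trans lt_m; exact: leq_addl.
rewrite (bigD1 (Ordinal lt_l)) //= [X in _ + X]big1 ?addr0; last first.
  by move=> l; rewrite -val_eqE /= => /negbTE nl; rewrite big1 // => c _; rewrite nl.
rewrite (bigD1 (Ordinal lt_c)) //= !eqxx /= big1 ?addr0 // => c.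
by rewrite -val_eqE /= => /negbTE ->.
Qed.

Hypothesis p_coprime : rel_prime p0 p1.
Hypothesis p0_neq0 : p0 != 0.

(** For fixed exponents [l] of [s] and [c] of [y] this is [syzygy_powers] for the
    pair [(p0, p1)]. *)
Lemma ker_conic G : conic_map G = 0 -> divides moving_line G.
Proof.
move=> G0; rewrite (graded_partE (leqnn (msize G))).
elim/big_ind: _ => [|f g|l _]; first by exists 0; rewrite mulr0.
  exact: divides_add.
elim/big_ind: _ => [|f g|c _]; first by exists 0; rewrite mulr0.
  exact: divides_add.
have [|e [el eE]] := @syzygy_powers A p0 p1 l (fun a => G@_(mon3 a (l - a) c))
    A_factorial p0_neq0 p_coprime.
  by rewrite -coef_conic G0 !coef0.
have -> : graded_part G l c = 'X_ord_max ^+ c *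
   \sum_(a < l.+1) (p0%:MP * (e a)%:MP
       - p1%:MP * (if (a : nat) is a'.+1 then (e a')%:MP else 0))
     * ('X_ord0 ^+ a * 'X_i31 ^+ (l - a)).
  rewrite mulr_sumr; apply: eq_bigr => a _; rewrite eE -1?ltnS //.
  have -> : (if (a : nat) is a'.+1 then (e a')%:MP else 0)
      = (if (a : nat) is a'.+1 then e a' else 0)%:MP :> {mpoly A[3]}.
    by case: (nat_of_ord a) => [|a'] //; rewrite mpolyC0.
  rewrite -!mpolyCM -mpolyCB mul_mpolyC !mpolyXD !mpolyXn -scalerAr.
  congr (_ *: _).
  by rewrite mulrC.
apply: divides_mulr; rewrite telescope_form ?el ?mpolyC0 //.
apply: divides_mull; exists (-1); rewrite /moving_line !mul_mpolyC; ring.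
Qed.

End Conic.

(** * The Rees map on the conic bundle *)

Section Rees.
Variables (A : idomainType) (n : nat) (u : 'I_n -> A).
Implicit Types (G H : {mpoly A[n]}).

(** The map [rees_map] over an arbitrary base ring and for any number of forms. *)
Definition rees G : {poly A} := mmap (@polyC A) (fun i => (u i)%:P * 'X) G.

Lemma rees0 : rees 0 = 0. Proof. exact: mmap0. Qed.

Lemma reesD G H : rees (G + H) = rees G + rees H.
Proof. exact: mmapD. Qed.

Lemma reesB G H : rees (G - H) = rees G - rees H.
Proof. exact: mmapB. Qed.

Lemma reesM G H : rees (G * H) = rees G * rees H.
Proof. exact: rmorphM. Qed.

Lemma reesZ c G : rees (c *: G) = c%:P * rees G.
Proof. exact: mmapZ. Qed.

Lemma reesX m : rees 'X_[m] = (\prod_i u i ^+ m i) *: 'X^(mdeg m).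
Proof.
rewrite /rees mmapX /mmap1 -mul_polyC rmorph_prod mdegE -prodrXr -big_split.
by apply: eq_bigr => i _; rewrite exprMn rmorphXn.
Qed.

Lemma reesXU i : rees 'X_i = (u i)%:P * 'X.
Proof. by rewrite /rees mmapX mmap1U. Qed.

Lemma rees_sum I (r : seq I) P (F : I -> {mpoly A[n]}) :
  rees (\sum_(i <- r | P i) F i) = \sum_(i <- r | P i) rees (F i).
Proof. exact: raddf_sum. Qed.

Lemma rees_homog1 G : G \is 1.-homog ->
  rees G = (\sum_i G@_U_(i) * u i)%:P * 'X.
Proof.
move=> /homog1E {1}->; rewrite rees_sum rmorph_sum mulr_suml.
by apply: eq_bigr => i _; rewrite reesZ reesXU mulrA -polyCM.
Qed.

End Rees.

Section ReesConic.
Variable A : idomainType.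
Hypothesis A_factorial : factorial_ring A.
Variables (p0 p1 w : A) (u : 'I_3 -> A).
Hypotheses (u0E : u ord0 = p0 * w) (u1E : u i31 = p1 * w).
Hypotheses (w_neq0 : w != 0) (w_coprime : rel_prime w (u ord_max)).
Implicit Types (G : {mpoly A[3]}) (m : 'X_{1..3}).

Local Notation psi := (conic_map p0 p1).

Lemma coef_rees G j : (rees u G)`_j =
  \sum_(l < j.+1) (psi G)`_(j - l)`_l * (w ^+ l * u ord_max ^+ (j - l)).
Proof.
elim/mpolyind: G => [|x m G _ _ IH].
  by rewrite rees0 conic_map0 coef0 big1 // => l _; rewrite !coef0 mul0r.
under eq_bigr do rewrite conic_mapD !coefD mulrDl.
rewrite reesD coefD big_split /= -IH; congr (_ + _).
under eq_bigr do rewrite conic_mapZ coefCM coefCM -mulrA.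
rewrite reesZ coefCM -mulr_sumr; congr (_ * _).
under eq_bigr do rewrite conic_mapX coefCM coefXn.
rewrite reesX coefZ coefXn big_ord3_prod u0E u1E mdeg3.
have [->|nj] := eqVneq j (m ord0 + m i31 + m ord_max)%N; last first.
  rewrite mulr0 big1 // => l _.
  have [E|] := eqVneq (j - l)%N (m ord_max); last by rewrite mulr0 coef0 mul0r.
  rewrite mulr1 coefZ coefXn; have [El|] := eqVneq (l : nat) (m ord0 + m i31)%N.
    by case/eqP: nj; rewrite -El -E subnKC // -ltnS.
  by rewrite mulr0 mul0r.
have lt : (m ord0 + m i31 < (m ord0 + m i31 + m ord_max).+1)%N.
  by rewrite ltnS leq_addr.
rewrite (bigD1 (Ordinal lt)) //= addKn !eqxx !mulr1 coefZ coefXn eqxx !mulr1.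
rewrite [X in _ = _ + X]big1 ?addr0 => [|l]; first by rewrite !exprMn exprD; ring.
rewrite -val_eqE /= => nl; case: eqP => [E|]; last by rewrite mulr0 coef0 mul0r.
by rewrite mulr1 coefZ coefXn (negbTE nl) mulr0 mul0r.
Qed.

(** The equation of the parametrized curve on the conic bundle: [s] and [y] are
    sent to [w Z] and [u2 Z]. *)
Definition curve_eq : {poly {poly A}} := w%:P%:P * 'X - (u ord_max *: 'X)%:P.

Lemma curve_eq_neq0 : curve_eq != 0.
Proof.
apply/eqP => /(congr1 (fun f : {poly {poly A}} => f`_1`_0)).
rewrite coefB coefCM coefX coefC /= subr0 mulr1 coefC !coef0 /= => /eqP.
by rewrite (negbTE w_neq0).
Qed.

Lemma coef_conic_big G l c : (msize G <= l + c)%N -> (psi G)`_c`_l = 0.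
Proof.
move=> le; rewrite coef_conic big1 // => a _.
rewrite memN_msupp_eq0 ?mul0r //; apply: msize_mdeg_ge.
by rewrite mdeg_mon3 subnKC // -ltnS.
Qed.

(** The terms of total degree [j] in [s] and [y] are those that [rees] sends to
    multiples of [Z ^+ j]. *)
Lemma conic_gradedE G : psi G = \sum_(j < msize G) \sum_(l < j.+1)
   ((psi G)`_(j - l)`_l *: 'X^l)%:P * 'X^(j - l).
Proof.
apply/polyP => c; apply/polyP => l.
have term (j l' : nat) (z : A) : (((z *: 'X^l')%:P * 'X^(j - l') : {poly {poly A}})`_c)`_l =
    if (j - l' == c)%N && (l' == l) then z else 0.
  rewrite coefCM coefXn eq_sym; case: eqP => _; last by rewrite mulr0 coef0.
  by rewrite mulr1 coefZ coefXn eq_sym; case: eqP => _; rewrite ?mulr1 ?mulr0.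
rewrite [X in _ = (polyseq X)`_l]coef_sum [RHS]coef_sum.
under eq_bigr do (rewrite coef_sum coef_sum; under eq_bigr do rewrite term).
have [lt|ge] := ltnP (l + c) (msize G); last first.
  rewrite (coef_conic_big ge) big1 // => j _; rewrite big1 // => l' _.
  case: ifP => // /andP [/eqP E /eqP El]; have := ltn_ord j.
  by rewrite ltnNge (leq_trans ge) // -El -E subnKC // -ltnS.
rewrite (bigD1 (Ordinal lt)) //= [X in _ + X]big1 ?addr0; last first.
  move=> j; rewrite -val_eqE /= => nj; rewrite big1 // => l' _.
  case: ifP => // /andP [/eqP E /eqP El]; case/eqP: nj.
  by rewrite -El -E subnKC // -ltnS.
have lt' : (l < (l + c).+1)%N by rewrite ltnS leq_addr.
rewrite (bigD1 (Ordinal lt')) //= addKn !eqxx big1 ?addr0 // => l'.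
by rewrite -val_eqE /= => /negbTE ->; rewrite andbF.
Qed.

(** A relation vanishes on the curve, so [curve_eq] divides its image; the
    coefficients of the quotient are given by the syzygies of the powers of
    [w] and [u2]. *)
Lemma rees_kernel_quotient G : rees u G = 0 -> exists e : nat -> nat -> A,
  (forall j l, (l <= j)%N -> (psi G)`_(j - l)`_l =
     w * e j l - u ord_max * (if l is l'.+1 then e j l' else 0)) /\
  psi G = curve_eq * \sum_(j < msize G) \sum_(l < j)
    ((e j l) *: 'X^l)%:P * 'X^(j.-1 - l).
Proof.
move=> G0.
have ex j : exists e : nat -> A, e j = 0 /\ forall l, (l <= j)%N ->
    (psi G)`_(j - l)`_l = w * e l - u ord_max * (if l is l'.+1 then e l' else 0).
  have := @syzygy_powers A w (u ord_max) j (fun l => (psi G)`_(j - l)`_l)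
    A_factorial w_neq0 w_coprime.
  by rewrite -coef_rees G0 coef0; apply.
pose e j := proj1_sig (constructive_indefinite_description _ (ex j)).
have eP j : e j j = 0 /\ forall l, (l <= j)%N -> (psi G)`_(j - l)`_l =
    w * e j l - u ord_max * (if l is l'.+1 then e j l' else 0).
  exact: proj2_sig (constructive_indefinite_description _ (ex j)).
exists e; split=> [j l le|]; first exact: (eP j).2.
rewrite {1}conic_gradedE mulr_sumr; apply: eq_bigr => j _.
transitivity (\sum_(l < j.+1) (w%:P%:P * (e j l)%:P%:P
    - (u ord_max)%:P%:P * (if (l : nat) is l'.+1 then (e j l')%:P%:P else 0))
    * (('X%:P) ^+ l * 'X ^+ (j - l)) : {poly {poly A}}).
  apply: eq_bigr => l _; rewrite (eP j).2 -1?ltnS //.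
  have -> : (if (l : nat) is l'.+1 then (e j l')%:P%:P else 0)
      = (if (l : nat) is l'.+1 then e j l' else 0)%:P%:P :> {poly {poly A}}.
    by case: (nat_of_ord l) => [|l'] //; rewrite !polyC0.
  by rewrite -mul_polyC polyCM rmorphXn -!polyCM -!polyCB mulrA.
rewrite telescope_form; last by rewrite (eP j).1 !polyC0.
rewrite /curve_eq -mul_polyC polyCM; congr (_ * _); apply: eq_bigr => l _.
by rewrite -mul_polyC polyCM rmorphXn mulrA.
Qed.

End ReesConic.

(** * Generation from powers of s *)

Section Generation.
Variable A : idomainType.
Hypothesis A_factorial : factorial_ring A.
Variables p0 p1 : A.
Hypotheses (p_coprime : rel_prime p0 p1) (p0_neq0 : p0 != 0).
Local Notation psi := (conic_map p0 p1).
Local Notation s := ('X%:P : {poly {poly A}}).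
Local Notation y := ('X : {poly {poly A}}).
Local Notation "a %:S" := ((a%:P)%:P : {poly {poly A}}) (at level 2, format "a %:S").

Variables (k : nat) (F : nat -> {mpoly A[3]}) (L : {mpoly A[3]}).
Variables (lam : {poly {poly A}}) (kap q c : A).
Hypotheses (k_ge2 : (2 <= k)%N) (kap_unit : kap \is a GRing.unit).
Hypothesis psiF : forall j, (0 < j < k)%N -> psi (F j) = kap%:S * (lam * s ^+ j.-1).
Hypothesis psiL :
  psi L = kap%:S * (lam * (s ^+ (k - 2) * (q%:S * s + c%:S * y))).

(** In the application [ord n] is the [n]-th power of the maximal ideal of the
    origin in [K[T]]. *)
Variable ord : nat -> A -> Prop.
Hypothesis ord2 : forall e, ord 2 e -> exists a b x, e = p0 * a + p1 * b + q * x.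
Hypothesis ord3 : forall n e, (3 <= n)%N -> ord n e ->
  exists a b, [/\ ord (n - 2) a, ord (n - 2) b & e = p0 * a + p1 * b].

Definition in_ideal (G : {mpoly A[3]}) := exists a (f : nat -> {mpoly A[3]}) l,
  G = a * moving_line p0 p1 + \sum_(1 <= j < k) f j * F j + l * L.

Definition in_image (Y : {poly {poly A}}) :=
  exists2 G, in_ideal G & psi G = Y.

Lemma in_idealD G H : in_ideal G -> in_ideal H -> in_ideal (G + H).
Proof.
move=> [a [f [l ->]]] [a' [f' [l' ->]]].
exists (a + a'), (fun j => f j + f' j), (l + l').
under [in RHS]eq_bigr do rewrite mulrDl.
by rewrite big_split /=; ring.
Qed.

Lemma in_idealM G H : in_ideal G -> in_ideal (H * G).
Proof.
move=> [a [f [l ->]]]; exists (H * a), (fun j => H * f j), (H * l).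
rewrite !mulrDr mulr_sumr !mulrA; congr (_ + _ + _).
by apply: eq_bigr => j _; rewrite mulrA.
Qed.

Lemma in_ideal_F j : (0 < j < k)%N -> in_ideal (F j).
Proof.
move=> /andP [j0 jk]; exists 0, (fun i => (i == j)%:R), 0.
rewrite !mul0r add0r addr0 (bigD1_seq j) ?mem_index_iota ?j0 ?iota_uniq //=.
by rewrite eqxx mul1r big1 ?addr0 // => i /negbTE ->; rewrite mul0r.
Qed.

Lemma in_ideal_L : in_ideal L.
Proof.
exists 0, (fun=> 0), 1; rewrite mul0r mul1r big1 ?add0r // => j _.
by rewrite mul0r.
Qed.

Lemma in_ideal_P : in_ideal (moving_line p0 p1).
Proof.
exists 1, (fun=> 0), 0; rewrite mul0r mul1r big1 ?addr0 // => j _.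
by rewrite mul0r.
Qed.

Lemma in_image0 : in_image 0.
Proof.
exists 0; last exact: conic_map0.
by have := in_idealM 0 in_ideal_L; rewrite mul0r.
Qed.

Lemma in_imageD Y Z : in_image Y -> in_image Z -> in_image (Y + Z).
Proof.
move=> [G Gi <-] [H Hi <-]; exists (G + H); first exact: in_idealD.
exact: conic_mapD.
Qed.

Lemma in_imageM H Y : in_image Y -> in_image (psi H * Y).
Proof.
by move=> [G Gi <-]; exists (H * G); [exact: in_idealM | exact: conic_mapM].
Qed.

Lemma in_imageC a Y : in_image Y -> in_image (a%:S * Y).
Proof.
move=> [G Gi <-]; exists (a%:MP * G); first exact: in_idealM.
by rewrite mul_mpolyC conic_mapZ.
Qed.

Lemma in_image_y n Y : in_image Y -> in_image (y ^+ n * Y).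
Proof.
move=> Yi; elim: n => [|n IH]; first by rewrite expr0 mul1r.
rewrite exprS -mulrA; have := in_imageM 'X_ord_max IH.
by rewrite conic_mapXU.
Qed.

Lemma in_image_p0 Y : in_image Y -> in_image (p0%:S * (s * Y)).
Proof.
move=> /(in_imageM 'X_ord0); rewrite conic_mapXU /conic_var /=.
by rewrite -mul_polyC polyCM mulrA.
Qed.

Lemma in_image_p1 Y : in_image Y -> in_image (p1%:S * (s * Y)).
Proof.
move=> /(in_imageM 'X_i31); rewrite conic_mapXU /conic_var /=.
by rewrite -mul_polyC polyCM mulrA.
Qed.

Lemma kapK Y : kap^-1%:S * (kap%:S * Y) = Y.
Proof. by rewrite mulrA -!polyCM mulVr // mul1r. Qed.

Lemma in_image_F j : (0 < j < k)%N -> in_image (lam * s ^+ j.-1).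
Proof.
move=> jk; rewrite -[lam * _]kapK -psiF //; apply: in_imageC.
by exists (F j) => //; exact: in_ideal_F.
Qed.

Lemma in_image_L : in_image (lam * (s ^+ (k - 2) * (q%:S * s + c%:S * y))).
Proof.
by rewrite -[lam * _]kapK -psiL; apply: in_imageC; exists L => //; exact: in_ideal_L.
Qed.

(** Beyond [s ^+ (k - 2)] a power of [s] can only be produced by [X0 = p0 s],
    [X1 = p1 s] and, once, by [L]. *)
Lemma in_image_high r e : ord (2 * r) e -> in_image (e%:S * (lam * s ^+ (k - 2 + r))).
Proof.
have base : in_image (lam * s ^+ (k - 2)).
  have -> : (k - 2 = (k - 1).-1)%N by lia.
  by apply: in_image_F; lia.
elim: r e => [|r IH] e oe; first by rewrite addn0; apply: in_imageC.
have [r0|r0] := posnP r.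
  rewrite r0 muln1 in oe; rewrite r0.
  have [a [b [x ->]]] := ord2 oe.
  have -> : (p0 * a + p1 * b + q * x)%:S * (lam * s ^+ (k - 2 + 1)) =
     p0%:S * (s * (a%:S * (lam * s ^+ (k - 2))))
     + p1%:S * (s * (b%:S * (lam * s ^+ (k - 2))))
     + (x%:S * (lam * (s ^+ (k - 2) * (q%:S * s + c%:S * y)))
        + (- (x * c))%:S * (y ^+ 1 * (lam * s ^+ (k - 2)))).
    by rewrite addn1 exprSr expr1 !polyCN !polyCD !polyCM; ring.
  apply: in_imageD; last first.
    apply: in_imageD; apply: in_imageC; first exact: in_image_L.
    exact: in_image_y.
  by apply: in_imageD; [apply: in_image_p0|apply: in_image_p1]; apply: in_imageC.
have [|a [b [oa ob ->]]] := ord3 _ oe; first by lia.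
have -> : (p0 * a + p1 * b)%:S * (lam * s ^+ (k - 2 + r.+1)) =
    p0%:S * (s * (a%:S * (lam * s ^+ (k - 2 + r))))
     + p1%:S * (s * (b%:S * (lam * s ^+ (k - 2 + r)))).
  by rewrite addnS exprSr !polyCD !polyCM; ring.
have E2 : (2 * r.+1 - 2 = 2 * r)%N by lia.
rewrite E2 in oa ob.
by apply: in_imageD; [apply: in_image_p0|apply: in_image_p1]; apply: IH.
Qed.

(** Up to [s ^+ (k - 2)] the image of one [F j] suffices. *)
Lemma in_image_term l n e : ord (2 * (l - (k - 2))) e ->
  in_image (lam * ((e *: 'X^l)%:P * 'X^n)).
Proof.
move=> oe; have -> : lam * ((e *: 'X^l)%:P * 'X^n) = y ^+ n * (e%:S * (lam * s ^+ l)).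
  by rewrite -mul_polyC polyCM rmorphXn; ring.
apply: in_image_y; have [le|lt] := leqP l (k - 2).
  by apply: in_imageC; rewrite -[l]/(l.+1.-1); apply: in_image_F; lia.
by rewrite -(subnKC (ltnW lt)); apply: in_image_high.
Qed.

(** An element with the same image as an element of the ideal differs from it by a
    multiple of the moving line. *)
Lemma in_ideal_of_quotient G N (e : nat -> nat -> A) :
  (forall j l, (l < j)%N -> ord (2 * (l - (k - 2))) (e j l)) ->
  psi G = lam * \sum_(j < N) \sum_(l < j) ((e j l) *: 'X^l)%:P * 'X^(j.-1 - l) ->
  in_ideal G.
Proof.
move=> oe GE.
have [H Hi HE] : in_image (psi G).
  rewrite GE mulr_sumr; elim/big_ind: _ => [|Y Z|j _].
  - exact: in_image0.
  - exact: in_imageD.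
  rewrite mulr_sumr; elim/big_ind: _ => [|Y Z|l _].
  - exact: in_image0.
  - exact: in_imageD.
  by apply: in_image_term; apply: oe.
have [B GH] : divides (moving_line p0 p1) (G - H).
  by apply: ker_conic => //; rewrite conic_mapB HE subrr.
rewrite -[G](subrK H) GH mulrC; apply: in_idealD => //.
exact: in_idealM in_ideal_P.
Qed.

End Generation.

(** * The part of degree zero in T *)

Lemma coef_rees_bounded (A : idomainType) n (u : 'I_n -> A) G N j : (msize G <= N)%N ->
  (rees u G)`_j = \sum_(m : 'X_{1..n < N} | mdeg m == j) G@_m * \prod_i u i ^+ m i.
Proof.
move=> sG; rewrite {1}[G](mpolywE sG) rees_sum coef_sum [RHS]big_mkcond /=.
apply: eq_bigr => m _; rewrite reesZ reesX coefCM coefZ coefXn eq_sym.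
by case: eqP; rewrite ?mulr1 ?mulr0.
Qed.

Section Forms.
Variable K : fieldType.

Definition lift_coef n (f : {mpoly K[n]}) : {mpoly {mpoly K[2]}[n]} :=
  map_mpoly (@mpolyC 2 K) f.

Definition coef_at0 n (G : {mpoly {mpoly K[2]}[n]}) : {mpoly K[n]} :=
  map_mpoly (mcoeff 0%MM) G.

Lemma mcoeff_lift n (f : {mpoly K[n]}) m : (lift_coef f)@_m = (f@_m)%:MP.
Proof. exact: mcoeff_map_mpoly. Qed.

Lemma mcoeff_at0 n (G : {mpoly {mpoly K[2]}[n]}) m : (coef_at0 G)@_m = (G@_m)@_0.
Proof. exact: (mcoeff_map_mpoly [the {additive _ -> _} of mcoeff 0%MM]). Qed.

Lemma lift_coefM n (f g : {mpoly K[n]}) : lift_coef (f * g) = lift_coef f * lift_coef g.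
Proof. exact: rmorphM. Qed.

Lemma lift_coefD n (f g : {mpoly K[n]}) : lift_coef (f + g) = lift_coef f + lift_coef g.
Proof. exact: raddfD. Qed.

Lemma coef_at0K n (f : {mpoly K[n]}) : coef_at0 (lift_coef f) = f.
Proof. by apply/mpolyP => m; rewrite mcoeff_at0 mcoeff_lift mcoeffC eqxx mulr1. Qed.

Section Graded.
Variables (n d : nat) (w : 'I_n -> {mpoly K[2]}).
Implicit Types f : {mpoly K[n]}.

Definition graded_subst f : {poly {mpoly K[2]}} := rees w (lift_coef f).

Lemma graded_substM f g : graded_subst (f * g) = graded_subst f * graded_subst g.
Proof. by rewrite /graded_subst lift_coefM reesM. Qed.

Lemma graded_substD f g : graded_subst (f + g) = graded_subst f + graded_subst g.
Proof. by rewrite /graded_subst lift_coefD reesD. Qed.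

Lemma coef_graded_subst f j : (graded_subst f)`_j = subst w (pihomog mdeg j f).
Proof.
pose N := maxn (msize f) (msize (lift_coef f)).
have sf : (msize f <= N)%N := leq_maxl _ _.
have sF : (msize (lift_coef f) <= N)%N := leq_maxr _ _.
rewrite /graded_subst (coef_rees_bounded w j sF) (pihomogwE _ _ sf) subst_sum.
by apply: eq_bigr => m _; rewrite substZ substX mcoeff_lift mul_mpolyC.
Qed.

(** A monomial of degree [j] in [X] becomes a form of degree [d * j] in [T], so the
    part of this degree only sees the constant terms of the coefficients. *)
Lemma coef_rees_at0 (G : {mpoly {mpoly K[2]}[n]}) j : (forall i, w i \is d.-homog) ->
  pihomog mdeg (d * j) (rees w G)`_j = subst w (pihomog mdeg j (coef_at0 G)).
Proof.
move=> wh; pose N := maxn (msize (coef_at0 G)) (msize G).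
have s0 : (msize (coef_at0 G) <= N)%N := leq_maxl _ _.
have sG : (msize G <= N)%N := leq_maxr _ _.
rewrite (coef_rees_bounded w j sG) (pihomogwE _ _ s0) subst_sum.
rewrite raddf_sum /=; apply: eq_bigr => m /eqP <-.
rewrite substZ mcoeff_at0 mulrC -substX -[(d * _)%N]addn0.
rewrite (pihomogMl _ _ (substX_homog wh m)) mulrC.
rewrite -mul_mpolyC; congr (_ * _).
apply/mpolyP => m'; rewrite mcoeff_pihomog mcoeffC mdeg_eq0.
by case: eqP => [->|]; rewrite ?mulr1 ?mulr0.
Qed.

End Graded.

Lemma pihomog_mwiden n (f : {mpoly K[n]}) j :
  pihomog mdeg j (mwiden f) = mwiden (pihomog mdeg j f).
Proof.
elim/mpolyind: f => [|c m f _ _ IH]; first by rewrite !raddf0.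
rewrite mwidenD !pihomogD mwidenD IH; congr (_ + _).
rewrite mwidenZ !linearZ /= mwidenZ mwidenX !pihomogX; congr (_ *: _); rewrite /=.
have -> : mdeg (mnmwiden m) = mdeg m.
  rewrite !mdegE big_ord_recr /= mnmwiden_ordmax addn0.
  by apply: eq_bigr => i _; rewrite mnmwiden_widen.
by case: ifP; rewrite ?mwidenX ?raddf0.
Qed.

Section CurveIdeal.
Variables (p0 p1 w : {mpoly K[2]}) (u : 'I_3 -> {mpoly K[2]}).
Hypotheses (p0_homog : p0 \is 2.-homog) (p1_homog : p1 \is 2.-homog).
Hypotheses (p_coprime : rel_prime p0 p1) (w_neq0 : w != 0).
Hypotheses (u0E : u ord0 = p0 * w) (u1E : u i31 = p1 * w).

(** Coprime forms of the same positive degree are algebraically independent: this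
    is [monomials_indep] with [e = 1]. *)
Lemma graded_subst_inj2 (f : {mpoly K[2]}) : graded_subst u (mwiden f) = 0 -> f = 0.
Proof.
move=> f0; apply/mpolyP => m; rewrite mcoeff0.
pose r := mdeg m.
have /(congr1 (fun g : {poly {mpoly K[2]}} => g`_r)) := f0.
rewrite coef_graded_subst coef0 pihomog_mwiden subst_mwiden.
rewrite (homog_bform (pihomogP mdeg r f)) subst_bform => E.
have lt : (1 < msize p0)%N.
  by rewrite (msize_homog p0_homog) // (pencil_neq0 p1_homog p_coprime).
have := @monomials_indep K p1 p0 1 r
  (fun _ j => (pihomog mdeg r f)@_(mon2 (r - j) j)) (rel_primeC p_coprime) lt.
rewrite big_ord1 => /(_ _ 0%N (m ord_max) isT).
have mE : mon2 (r - m ord_max) (m ord_max) = m.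
  by rewrite [RHS]mon2K /r mdeg2 addnK.
rewrite mE mcoeff_pihomog eqxx; apply; last by rewrite /r mdeg2 leq_addl.
apply: (@mulfI _ (w ^+ r)); first by rewrite expf_neq0.
rewrite mulr0; apply: etrans E; rewrite mulrCA mpolyX_mon2 !expr0 !mul1r.
rewrite (reindex_inj rev_ord_inj) /= mulr_sumr; apply: eq_bigr => j _.
have le_j : (j <= r)%N by rewrite -ltnS.
rewrite !subSS subKn // /u01.
rewrite (_ : widen_ord _ ord0 = ord0); last exact: val_inj.
rewrite (_ : widen_ord _ ord_max = i31); last exact: val_inj.
rewrite u0E u1E !exprMn mulrACA -exprD subnKC // -scalerAr.
by congr (_ *: _); ring.
Qed.

(** Over the field [K(X0, X1)] the polynomials in [X2] vanishing on the curve
    form a proper ideal, so [E] and [f] have a common factor there; being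
    prime, [E] is this factor. *)
Lemma prime_divides_curve_kernel (E f : {mpoly K[3]}) : prime_elt E ->
  graded_subst u E = 0 -> graded_subst u f = 0 -> divides E f.
Proof.
move=> [E0 Eu Ediv] gE gf.
have [cop|ncop] := boolP (coprimep (muni E) (muni f)).
  have [[a b] /= /Pdiv.Idomain.eqpP [[c1 c2] /= /andP [c10 c20] eq1]] :=
    Pdiv.Idomain.Bezout_coprimepP _ _ cop.
  have eq2 : mwiden c1 * (muni_inv a * E + muni_inv b * f) = mwiden c2.
    apply: muni_inj; rewrite muniM muni_mwiden muniD [muni (muni_inv a * E)]muniM.
    rewrite [muni (muni_inv b * f)]muniM [muni (muni_inv a)]muni_invK.
    rewrite [muni (muni_inv b)]muni_invK muni_mwiden mul_polyC.
    by rewrite eq1 alg_polyC.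
  case/eqP: c20; apply: graded_subst_inj2; rewrite -eq2.
  rewrite graded_substM graded_substD (graded_substM u (muni_inv a) E).
  rewrite (graded_substM u (muni_inv b) f) gE gf.
  have zero (R : comNzRingType) (x y z : R) : x * (y * 0 + z * 0) = 0 by ring.
  exact: zero.
move: ncop; rewrite /coprimep; set g := gcdp _ _ => sg.
have pull (h : {mpoly K[3]}) : (g %| muni h)%R ->
    exists (c : {mpoly K[2]}) (r : {mpoly K[3]}),
      c != 0 /\ mwiden c * h = r * muni_inv g.
  move=> /Pdiv.Idomain.dvdpP [[c r] /= c0 eq1]; exists c, (muni_inv r); split=> //.
  apply: muni_inj; rewrite muniM muni_mwiden [muni (muni_inv r * _)]muniM.
  by rewrite [muni (muni_inv r)]muni_invK [muni (muni_inv g)]muni_invK mul_polyC.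
have [c1 [r1 [c10 eq1]]] := pull E (dvdp_gcdl _ _).
have [c2 [r2 [c20 eq2]]] := pull f (dvdp_gcdr _ _).
have [] : divides E r1 \/ divides E (muni_inv g).
- by apply: Ediv; rewrite -eq1; apply: divides_mulr; exact: divides_refl.
- move=> [x r1E]; rewrite r1E -mulrA mulrC in eq1.
  have := congr1 (@muni 2 K) (mulfI E0 eq1).
  rewrite muni_mwiden muniM [muni (muni_inv g)]muni_invK => eq3.
  have nz : muni x * g != 0 by rewrite -eq3 polyC_eq0.
  move: (nz); rewrite mulf_eq0 negb_or => /andP [x0 g0].
  have := size_mul x0 g0; rewrite -eq3 size_polyC c10.
  move: sg x0 g0; rewrite -!size_poly_eq0.
  move: (size g) (size (muni x)) => a b; lia.
move=> Eg.
have [] : divides E (mwiden c2) \/ divides E f.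
- by apply: Ediv; rewrite eq2; apply: divides_mulr.
- move=> [x c2E]; case/eqP: c20; apply: graded_subst_inj2.
  by rewrite c2E graded_substM gE mul0r.
by [].
Qed.

End CurveIdeal.
End Forms.

(** * Combinations of the generators, degree by degree *)

Section LinearForms.
Variables (A : idomainType) (p0 p1 : A) (u : 'I_3 -> A).
Implicit Types G : {mpoly A[3]}.

Lemma rees_homog1_syzygy G : G \is 1.-homog -> rees u G = 0 ->
  G@_U_(ord0) * u ord0 + G@_U_(i31) * u i31 + G@_U_(ord_max) * u ord_max = 0.
Proof.
move=> /rees_homog1 -> /eqP; rewrite mulf_eq0 polyX_eq0 orbF polyC_eq0 => /eqP.
by rewrite big_ord3.
Qed.

Lemma conic_homog1 G : G \is 1.-homog -> conic_map p0 p1 G =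
  ((G@_U_(ord0) * p0 + G@_U_(i31) * p1) *: 'X)%:P + (G@_U_(ord_max))%:P%:P * 'X.
Proof.
move=> /homog1E {1}->; rewrite big_ord3 !conic_mapD !conic_mapZ !conic_mapXU.
rewrite /conic_var /=; move: (G@_U_(ord0)) (G@_U_(i31)) (G@_U_(ord_max)) => a b c.
rewrite -3!mul_polyC !polyCM !polyCD !polyCM; ring.
Qed.

Lemma moving_lineE G : G \is 1.-homog -> G@_U_(ord_max) = 0 ->
  G = moving_line (- G@_U_(i31)) (G@_U_(ord0)).
Proof.
move=> Gh G2; rewrite {1}(homog1E Gh) big_ord3 G2 scale0r addr0 /moving_line.
by rewrite scaleNr opprK.
Qed.

Lemma conic_moving_line : conic_map p0 p1 (moving_line p0 p1) = 0.
Proof.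
rewrite /moving_line conic_mapB !conic_mapZ !conic_mapXU /conic_var /=.
rewrite -!mul_polyC !polyCM; ring.
Qed.

Lemma conic_scale_eq0 G x : conic_map p0 p1 G != 0 ->
  conic_map p0 p1 (G * x%:MP) = 0 -> x = 0.
Proof.
move=> G0; rewrite mulrC mul_mpolyC conic_mapZ => /eqP.
by rewrite mulf_eq0 (negbTE G0) orbF !polyC_eq0 => /eqP.
Qed.

Lemma pihomog0E n (R : comNzRingType) (H : {mpoly R[n]}) :
  pihomog mdeg 0 H = (H@_0)%:MP.
Proof.
apply/mpolyP => m; rewrite mcoeff_pihomog mcoeffC mdeg_eq0.
by case: eqP => [->|]; rewrite ?mulr1 ?mulr0.
Qed.

(** Only the part of degree 0 of [H] contributes to a product of degree [e]. *)
Lemma homog_divides_scale n (R : comNzRingType) e (G H : {mpoly R[n]}) :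
  G \is e.-homog -> G * H \is e.-homog -> G * H = H@_0 *: G.
Proof.
move=> Gh GHh; rewrite -(pihomog_dE GHh) -[e in LHS]addn0 (pihomogMl _ _ Gh).
by rewrite pihomog0E mulrC mul_mpolyC.
Qed.

End LinearForms.

Section Minimality.
Variable A : idomainType.
Variables p0 p1 : A.
Local Notation psi := (conic_map p0 p1).
Local Notation s := ('X%:P : {poly {poly A}}).
Local Notation "a %:S" := ((a%:P)%:P : {poly {poly A}}) (at level 2, format "a %:S").
Local Notation P := (moving_line p0 p1).

Variables (k D : nat) (F : nat -> {mpoly A[3]}) (L B : {mpoly A[3]}).
Variables (lam : {poly {poly A}}) (kap : A).
Hypotheses (kap_neq0 : kap != 0) (lam_neq0 : lam != 0).
Hypothesis psiF : forall j, (0 < j < k)%N -> psi (F j) = kap%:S * (lam * s ^+ j.-1).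
Hypothesis F_homog : forall j, (0 < j < k)%N -> F j \is j.-homog.
Hypotheses (L_homog : L \is k.-homog) (B_homog : B \is D.-homog).

Lemma moving_line_homog : P \is 1.-homog.
Proof. by apply: rpredB; apply: rpredZ; rewrite dhomogX /= mdeg1. Qed.

(** A generator of degree [j] in [X] contributes through the part of degree
    [n - j] of its coefficient, hence not at all when [j > n]. *)
Lemma pihomog_combination n b a (c : nat -> {mpoly A[3]}) l :
  (0 < n)%N -> (n < D)%N -> (n < k)%N \/ l = 0 ->
  pihomog mdeg n (b * B + a * P + \sum_(1 <= j < k) c j * F j + l * L) =
  P * pihomog mdeg n.-1 a
  + \sum_(1 <= j < k) if (j <= n)%N then F j * pihomog mdeg (n - j) (c j) else 0.
Proof.
move=> n0 nD nk; rewrite !pihomogD.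
rewrite [b * B]mulrC (pihomogMl_small _ B_homog) // add0r.
rewrite [pihomog mdeg n (l * L)](_ : _ = 0); last first.
  case: nk => [nk|->]; last by rewrite mul0r pihomog0.
  by rewrite mulrC (pihomogMl_small _ L_homog).
rewrite addr0; congr (_ + _).
  have nE : n = (1 + n.-1)%N by rewrite add1n prednK.
  by rewrite mulrC {1}nE (pihomogMl _ _ moving_line_homog).
rewrite raddf_sum /=; apply: eq_big_nat => j jk; rewrite mulrC.
have [le|lt] := leqP j n; last by rewrite (pihomogMl_small _ (F_homog jk)).
have nE : n = (j + (n - j))%N by rewrite subnKC.
by rewrite {1}nE (pihomogMl _ _ (F_homog jk)).
Qed.

(** Under [conic_map] the moving line disappears, [lam] can be cancelled, and what
    remains is compared in the coefficient of [s ^+ n.-1]. *)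
Lemma coef_combination n b a (c : nat -> {mpoly A[3]}) l X Z :
  (0 < n)%N -> (n < D)%N -> (n < k)%N \/ l = 0 -> X \is n.-homog ->
  psi X = kap%:S * (lam * Z) ->
  X = b * B + a * P + \sum_(1 <= j < k) c j * F j + l * L ->
  Z`_0`_n.-1 = \sum_(1 <= j < k)
     if (j <= n)%N then (psi (pihomog mdeg (n - j) (c j)))`_0`_(n - j) else 0.
Proof.
move=> n0 nD nk Xh psiX XE.
have := congr1 psi (pihomog_combination b a c n0 nD nk).
rewrite -XE (pihomog_dE Xh) psiX conic_mapD conic_mapM conic_moving_line.
rewrite mul0r add0r conic_map_sum.
have -> : \sum_(1 <= j < k) psi (if (j <= n)%N then F j * pihomog mdeg (n - j) (c j) else 0)
  = kap%:S * (lam * \sum_(1 <= j < k) if (j <= n)%N then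
       s ^+ j.-1 * psi (pihomog mdeg (n - j) (c j)) else 0).
  rewrite !mulr_sumr; apply: eq_big_nat => j jk.
  case: ifP => _; last by rewrite conic_map0 !mulr0.
  by rewrite conic_mapM psiF // -!mulrA.
have kS0 : kap%:S != 0 by rewrite !polyC_eq0.
move=> /(mulfI kS0) /(mulfI lam_neq0) ->.
rewrite coef_sum coef_sum; apply: eq_big_nat => j /andP [j0 jk].
case: ifP => le; last by rewrite !coef0.
rewrite -rmorphXn coefCM coefXnM.
have -> : (n.-1 < j.-1)%N = false by lia.
by congr (_`_ _); lia.
Qed.

End Minimality.

(** * From the basis of moving lines to the conic bundle *)

Section Steps.
Variable A : idomainType.
Variables (p0 p1 : A) (u : 'I_3 -> A).
Implicit Types (G H X : {mpoly A[3]}).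
Local Notation psi := (conic_map p0 p1).
Local Notation s := ('X%:P : {poly {poly A}}).
Local Notation y := ('X : {poly {poly A}}).
Local Notation "a %:S" := ((a%:P)%:P : {poly {poly A}}) (at level 2, format "a %:S").

Lemma rees_comb x x' G H : rees u G = 0 -> rees u H = 0 ->
  rees u (x *: G + x' *: H) = 0.
Proof. by move=> G0 H0; rewrite reesD !reesZ G0 H0 !mulr0 addr0. Qed.

Lemma rees_scale_eq0 x G : x != 0 -> rees u (x *: G) = 0 -> rees u G = 0.
Proof.
by move=> x0 /eqP; rewrite reesZ mulf_eq0 polyC_eq0 (negbTE x0) => /eqP.
Qed.

Lemma rees_combM B B' G H : rees u G = 0 -> rees u H = 0 ->
  rees u (B * G + B' * H) = 0.
Proof. by move=> G0 H0; rewrite reesD !reesM G0 H0 !mulr0 addr0. Qed.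

(** The operator [D_T] becomes multiplication by [s]. *)
Lemma conic_DT G0 G1 G : G = p0 *: G0 + p1 *: G1 ->
  psi ('X_ord0 * G0 + 'X_i31 * G1) = s * psi G.
Proof.
move=> ->; rewrite !conic_mapD !conic_mapM !conic_mapZ !conic_mapXU /conic_var /=.
rewrite -2!mul_polyC !polyCM; move: (psi G0) (psi G1) => a b; ring.
Qed.

Lemma rees_DT G0 G1 G : p0 != 0 -> rees u (moving_line p0 p1) = 0 ->
  G = p0 *: G0 + p1 *: G1 -> rees u G = 0 ->
  rees u ('X_ord0 * G0 + 'X_i31 * G1) = 0.
Proof.
move=> p00 P0 GE G0'; apply: (rees_scale_eq0 p00).
have -> : p0 *: ('X_ord0 * G0 + 'X_i31 * G1)
    = 'X_ord0 * G + (- G1) * moving_line p0 p1.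
  rewrite GE /moving_line -!mul_mpolyC.
  by move: ('X_ord0) ('X_i31) => a b; ring.
exact: rees_combM.
Qed.

Lemma sylvester_elim t0 t1 a0 a1 G H :
  t0 *: (a0 * G + a1 * H)
  = a0 * (t0 *: G + t1 *: H) + H * (t0 *: a1 - t1 *: a0).
Proof. by rewrite -!mul_mpolyC; ring. Qed.

Lemma rees_sylvester t0 t1 a0 a1 G H : t0 != 0 ->
  rees u (t0 *: G + t1 *: H) = 0 -> rees u (t0 *: a1 - t1 *: a0) = 0 ->
  rees u (a0 * G + a1 * H) = 0.
Proof.
move=> t00 P0 F0; apply: (rees_scale_eq0 t00).
by rewrite (sylvester_elim t0 t1); apply: rees_combM.
Qed.

(** The first term on the right of [sylvester_elim] has image zero, and [t0] can be
    cancelled since it divides the image of [H]. *)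
Lemma conic_sylvester t0 t1 a0 a1 G H q c : t0 != 0 ->
  psi (t0 *: G + t1 *: H) = 0 -> H \is 1.-homog ->
  H@_U_(ord0) * p0 + H@_U_(i31) * p1 = t0 * q -> H@_U_(ord_max) = t0 * c ->
  psi (a0 * G + a1 * H) = psi (t0 *: a1 - t1 *: a0) * (q%:S * s + c%:S * y).
Proof.
move=> t00 P0 Hh Eq Ec; have tS0 : t0%:S != 0 by rewrite !polyC_eq0.
apply: (mulfI tS0); rewrite -conic_mapZ (sylvester_elim t0 t1) conic_mapD.
rewrite conic_mapM P0 mulr0 add0r conic_mapM (conic_homog1 _ _ Hh) Eq Ec.
rewrite -mul_polyC !polyCM; move: (psi _) => a; ring.
Qed.

End Steps.

Section Structure.
Variables (K : closedFieldType) (d k : nat).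
Variables (u : 'I_3 -> {mpoly K[2]}) (P Q : {mpoly {mpoly K[2]}[3]}).
Hypotheses (k_ge2 : (2 <= k)%N) (d_eq : d = (2 * k - 1)%N).
Hypothesis u_homog : forall i, u i \is d.-homog.
Hypothesis u_coprime : no_common_factor u.
Hypothesis PQ_basis : mu_basis u d 2 P Q.

Lemma k_ge3 : (3 <= k)%N.
Proof. by case: PQ_basis; rewrite d_eq; lia. Qed.

Lemma P_homog : P \is 1.-homog. Proof. by case: PQ_basis => _ [[]]. Qed.
Lemma Q_homog : Q \is 1.-homog. Proof. by case: PQ_basis => _ _ [[]]. Qed.
Lemma P_coef_homog m : P@_m \is 2.-homog. Proof. by case: PQ_basis => _ [[_]]. Qed.
Lemma Q_coef_homog m : Q@_m \is (d - 2).-homog.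
Proof. by case: PQ_basis => _ _ [[_]]. Qed.
Lemma rees_P : rees u P = 0. Proof. by case: PQ_basis => _ []. Qed.
Lemma rees_Q : rees u Q = 0. Proof. by case: PQ_basis => _ _ []. Qed.

Lemma basis_exists G : rees u G = 0 -> G \is 1.-homog ->
  exists x y, G = x *: P + y *: Q.
Proof.
by case: PQ_basis => _ _ _ b G0 Gh; have [[x y] [GE _]] := b G G0 Gh; exists x, y.
Qed.

Lemma basis_unique x y x' y' : x *: P + y *: Q = x' *: P + y' *: Q ->
  x = x' /\ y = y'.
Proof.
case: PQ_basis => _ _ _ b E.
have G0 : rees u (x *: P + y *: Q) = 0 by apply: rees_comb; [exact: rees_P | exact: rees_Q].
have Gh : x *: P + y *: Q \is 1.-homog.
  by apply: rpredD; apply: rpredZ; [exact: P_homog | exact: Q_homog].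
have [ab [_ uniq]] := b _ G0 Gh.
have := uniq (x, y) erefl; rewrite (uniq (x', y') E) => -[-> ->]; by [].
Qed.

Lemma P_neq0 : P != 0.
Proof.
apply/eqP => P0; have [|/eqP] := @basis_unique 1 0 0 0.
  by rewrite P0 !scaler0.
by rewrite oner_eq0.
Qed.

Variable E : {mpoly K[3]}.
Hypothesis u_proper : proper_param u.
Hypotheses (E_neq0 : E != 0) (E_homog : E \is d.-homog).
Hypotheses (E_curve : defines_curve u E) (E_mult : (2 < mult E (point001 K))%N).

Local Notation p0 := (- P@_U_(i31)).
Local Notation p1 := (P@_U_(ord0)).

Lemma P_no_X2 : P@_U_(ord_max) = 0.
Proof.
have d3 : (2 < d)%N by rewrite d_eq; move: k_ge3; lia.
apply: (very_singular_no_X2 d3 u_homog u_coprime u_proper E_homog E_neq0 E_curve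
  E_mult (P_coef_homog _)).
exact: rees_homog1_syzygy P_homog rees_P.
Qed.

Lemma P_moving_line : P = moving_line p0 p1.
Proof. exact: moving_lineE P_homog P_no_X2. Qed.

Lemma p0_homog : p0 \is 2.-homog. Proof. by rewrite rpredN; exact: P_coef_homog. Qed.
Lemma p1_homog : p1 \is 2.-homog. Proof. exact: P_coef_homog. Qed.

(** A common factor of [p0] and [p1] could be divided out of [P], which is part
    of a basis. *)
Lemma p_coprime : rel_prime p0 p1.
Proof.
move=> g [a aE] [b bE].
have PE : P = g *: moving_line a b.
  rewrite {1}P_moving_line aE bE /moving_line scalerBr !scalerA //.
have g0 : g != 0.
  by apply: contra P_neq0 => /eqP g0; rewrite PE g0 scale0r.
have P'0 : rees u (moving_line a b) = 0.
  by apply: (rees_scale_eq0 g0); rewrite -PE; exact: rees_P.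
have [x [y P'E]] := basis_exists P'0 (moving_line_homog a b).
have [|gx _] := @basis_unique (g * x) (g * y) 1 0.
  by rewrite scale1r scale0r addr0 -2!scalerA -scalerDr -P'E -PE.
by apply/unitrP; exists x; rewrite mulrC.
Qed.

Lemma p0_neq0 : p0 != 0. Proof. exact: pencil_neq0 p1_homog p_coprime. Qed.

(** The relation [P] reads [p1 * u0 = p0 * u1], and [p0], [p1] are coprime. *)
Lemma factor_w : exists w, [/\ w \is (d - 2).-homog, w != 0,
  u ord0 = p0 * w, u i31 = p1 * w & rel_prime w (u ord_max)].
Proof.
have syz : p1 * u ord0 = p0 * u i31.
  have := rees_homog1_syzygy P_homog rees_P; rewrite P_no_X2 mul0r addr0.
  by move=> /eqP; rewrite addr_eq0 => /eqP ->; rewrite mulNr.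
have [w' w'E] : divides p0 (u ord0).
  apply: (rel_prime_divides (@mpoly_factorial K 2) p0_neq0 p_coprime).
  by exists (u i31).
have dE : d = (2 + (d - 2))%N by rewrite d_eq; move: k_ge3; lia.
(* The quotient [w'] is replaced by its part of the right degree. *)
pose w := pihomog mdeg (d - 2) w'; exists w.
have u0E : u ord0 = p0 * w.
  rewrite -(pihomog_dE (u_homog ord0)) w'E {1}dE.
  exact: pihomogMl p0_homog.
have u1E : u i31 = p1 * w.
  apply: (mulfI p0_neq0); rewrite -syz u0E mulrCA; by [].
have cop : rel_prime w (u ord_max).
  move=> g gw g2; apply: (common_divisor_unit u_coprime) => //.
    by rewrite u0E; apply: divides_mulr.
  by rewrite u1E; apply: divides_mulr.
split=> //; first exact: pihomogP.
apply/eqP => w0; have := not_unit_homog (n := d.-1) (f := u ord_max).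
rewrite prednK; last by rewrite d_eq; move: k_ge3; lia.
move=> /(_ (u_homog _)) /negP; apply; apply: cop; last exact: divides_refl.
by rewrite w0; exists 0; rewrite mulr0.
Qed.

(** Modulo [w] the relation [Q] only involves [u2], so [w] divides the coefficient
    of [X2] in [Q]; they have the same degree, so the quotient is a constant. If it
    were zero, [Q] would be a multiple of [P]. *)
Lemma conic_Q w : w \is (d - 2).-homog -> w != 0 ->
  u ord0 = p0 * w -> u i31 = p1 * w -> rel_prime w (u ord_max) ->
  exists2 kap : K, kap != 0 &
    conic_map p0 p1 Q = kap%:MP%:P%:P * curve_eq w u.
Proof.
move=> wh w0 u0E u1E cop.
have syz := rees_homog1_syzygy Q_homog rees_Q.
have [x q2E'] : divides w (Q@_U_(ord_max)).
  apply: (rel_prime_divides (@mpoly_factorial K 2) w0 cop).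
  exists (- (Q@_U_(ord0) * p0 + Q@_U_(i31) * p1)).
  apply/eqP; rewrite -subr_eq0 -[X in _ == X]syz u0E u1E; apply/eqP.
  move: (Q@_U_(ord0)) (Q@_U_(i31)) (Q@_U_(ord_max)) => a b c; ring.
have q2E : Q@_U_(ord_max) = x@_0 *: w.
  rewrite q2E'; apply: (homog_divides_scale wh).
  by rewrite -q2E'; exact: Q_coef_homog.
have lin : Q@_U_(ord0) * p0 + Q@_U_(i31) * p1 = - (x@_0 *: u ord_max).
  apply: (mulfI w0); apply/eqP; rewrite -subr_eq0 -[X in _ == X]syz u0E u1E q2E.
  apply/eqP; rewrite -!mul_mpolyC.
  move: (Q@_U_(ord0)) (Q@_U_(i31)) ((x@_0)%:MP) => a b c; ring.
have psiQ : conic_map p0 p1 Q = (x@_0)%:MP%:P%:P * curve_eq w u.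
  rewrite (conic_homog1 _ _ Q_homog) lin q2E /curve_eq -!mul_mpolyC.
  move: ((x@_0)%:MP) (u ord_max) => a b.
  rewrite -2!mul_polyC !polyCN !polyCM !polyCN !polyCM; ring.
exists x@_0 => //; apply/eqP => x0; rewrite x0 mpolyC0 !polyC0 mul0r in psiQ.
have [H QE] := ker_conic (@mpoly_factorial K 2) p_coprime p0_neq0 psiQ.
have Q_hom := Q_homog.
have QE' : Q = H@_0 *: P.
  rewrite QE -P_moving_line; apply: homog_divides_scale; first exact: P_homog.
  by rewrite {1}P_moving_line -QE.
have [|_ /eqP] := @basis_unique (H@_0) 0 0 1.
  by rewrite scale0r addr0 scale0r add0r scale1r.
by rewrite eq_sym oner_eq0.
Qed.

End Structure.

(** * The images of the F_j and of the last generator *)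

Section AtZero.
Variable K : fieldType.
Implicit Types G H : {mpoly {mpoly K[2]}[3]}.

Lemma coef_at0D G H : coef_at0 (G + H) = coef_at0 G + coef_at0 H.
Proof. by apply/mpolyP => m; rewrite mcoeffD !mcoeff_at0 !mcoeffD. Qed.

Lemma coef_at0M G H : coef_at0 (G * H) = coef_at0 G * coef_at0 H.
Proof. exact: (rmorphM (map_mpoly [the {rmorphism _ -> _} of mcoeff 0%MM])). Qed.

Lemma coef_at0_pos i G : (0 < i)%N -> (forall m, G@_m \is i.-homog) -> coef_at0 G = 0.
Proof.
move=> i0 Gh; apply/mpolyP => m; rewrite mcoeff_at0 mcoeff0.
by apply: (dhomog_nemf_coeff (Gh m)); rewrite /= mdeg0 eq_sym -lt0n.
Qed.

Lemma lift_homog n j (f : {mpoly K[n]}) : f \is j.-homog -> lift_coef f \is j.-homog.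
Proof.
move=> /dhomogP fh; apply/dhomogP => m; rewrite mcoeff_msupp mcoeff_lift => nz.
by apply: fh; rewrite mcoeff_msupp; apply: contraNneq nz => ->; rewrite mpolyC0.
Qed.

End AtZero.

Section Sequence.
Variables (K : closedFieldType) (d k : nat) (u : 'I_3 -> {mpoly K[2]}).
Variables (P Q : {mpoly {mpoly K[2]}[3]}) (F : nat -> {mpoly {mpoly K[2]}[3]}).
Local Notation p0 := (- P@_U_(i31)).
Local Notation p1 := (P@_U_(ord0)).
Local Notation psi := (conic_map p0 p1).
Local Notation s := ('X%:P : {poly {poly {mpoly K[2]}}}).
Local Notation y := ('X : {poly {poly {mpoly K[2]}}}).
Local Notation "a %:S" := ((a%:P)%:P : {poly {poly {mpoly K[2]}}})
  (at level 2, format "a %:S").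
Variables (lam : {poly {poly {mpoly K[2]}}}) (kap : {mpoly K[2]}).
Hypotheses (p0_neq0 : p0 != 0) (P_line : P = moving_line p0 p1).
Hypotheses (k_ge3 : (3 <= k)%N) (d_eq : d = (2 * k - 1)%N).
Hypotheses (rees_P : rees u P = 0) (rees_Q : rees u Q = 0).
Hypotheses (Q_homog : Q \is 1.-homog) (Q_coef : forall m, Q@_m \is (d - 2).-homog).
Hypothesis psiQ : psi Q = kap%:S * lam.
Hypothesis F_def : F_sequence P Q k F.

(** Starting from [conic_Q], each application of [D_T] contributes a factor [s]
    by [conic_DT]. *)
Lemma F_sequence_facts j : (0 < j < k)%N ->
  [/\ psi (F j) = kap%:S * (lam * s ^+ j.-1), F j \is j.-homog,
      coef_at0 (F j) = 0 & rees u (F j) = 0].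
Proof.
have [F1 Fstep] := F_def.
elim: j => [//|j IH] /andP [_ jk].
have [->|j0] := posnP j.
  rewrite F1; split=> //; first by rewrite expr0 mulr1 psiQ.
  by apply: (coef_at0_pos (i := d - 2)) => //; rewrite d_eq; move: k_ge3; lia.
have jk' : (0 < j < k)%N by rewrite j0 ltnW.
have [psiFj Fjh _ rFj] := IH jk'.
have [|G0 [G1 [[i3 _] [G0h G0c] [G1h G1c] FE FSE]]] := Fstep j.+1; first by lia.
rewrite subSS subn0 in FE G0h G1h.
have FSE' : F j.+1 = 'X_ord0 * G0 + 'X_i31 * G1 by exact: FSE.
have X1h (i : 'I_3) : ('X_i : {mpoly {mpoly K[2]}[3]}) \is 1.-homog.
  by rewrite dhomogX /= mdeg1.
split.
- apply: etrans (congr1 psi FSE') _; apply: etrans (conic_DT FE) _.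
  have perm (R : comNzRingType) (b c e : R) : e * (b * (c * e ^+ j.-1)) = b * (c * e ^+ j).
    by rewrite -[in RHS](prednK j0) exprS; ring.
  by rewrite psiFj; exact: (perm _ kap%:S lam s).
- rewrite FSE' -[j.+1]/(1 + j)%N.
  by apply: rpredD; apply: dhomogM => //; exact: X1h.
- rewrite FSE' coef_at0D !coef_at0M.
  rewrite (coef_at0_pos (i := 2 * (k - j.+1 + 1) - 1 - 2) _ G0c); last by move: jk; lia.
  rewrite (coef_at0_pos (i := 2 * (k - j.+1 + 1) - 1 - 2) _ G1c); last by move: jk; lia.
  by rewrite !mulr0 addr0.
rewrite FSE'; apply: (rees_DT p0_neq0 _ FE rFj).
by rewrite -P_line.
Qed.

Variable L : {mpoly {mpoly K[2]}[3]}.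
Hypothesis L_def : last_F P (F (k - 1)%N) k L.
Hypothesis P_no_X2 : P@_U_(ord_max) = 0.

(** The last generator eliminates [T0] and [T1] between [P] and [F (k - 1)], which
    brings in the Sylvester form of [p0] and [p1] by [conic_sylvester]. *)
Lemma last_F_facts : exists g0 h0 g1 h1 c : {mpoly K[2]},
  [/\ [/\ g0 \is 1.-homog, h0 \is 1.-homog, g1 \is 1.-homog & h1 \is 1.-homog],
      p0 = 'X_ord0 * g0 + 'X_ord_max * h0,
      p1 = 'X_ord0 * g1 + 'X_ord_max * h1,
      psi L = kap%:S * (lam * (s ^+ (k - 2) *
                (((sylvester_form g0 h0 g1 h1)%:S) * s + c%:S * y)))
    & [/\ L \is k.-homog, coef_at0 L = 0 & rees u L = 0]].
Proof.
have [G [H [f0 [f1 [[[Gh Gc] [Hh Hc]] [f0h f1h] PE' FE' LE']]]]] :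
  exists (G H : {mpoly {mpoly K[2]}[3]}) (f0 f1 : {mpoly K[3]}),
    [/\ (G \is 1.-homog /\ forall m, G@_m \is 1.-homog) /\
        (H \is 1.-homog /\ forall m, H@_m \is 1.-homog),
        f0 \is (k - 1).-homog /\ f1 \is (k - 1).-homog,
        P = 'X_ord0 *: G + 'X_ord_max *: H,
        F (k - 1)%N = 'X_ord0 *: lift_coef f1 - 'X_ord_max *: lift_coef f0
      & L = lift_coef f0 * G + lift_coef f1 * H] := L_def.
have Pm m : P@_m = 'X_ord0 * G@_m + 'X_ord_max * H@_m.
  by rewrite {1}PE' mcoeffD !mcoeffZ.
have X0n : ('X_ord0 : {mpoly K[2]}) != 0 by rewrite -msize_poly_eq0 msizeX.
(* Since [P] has no term in [X2], those of [G] and [H] form a syzygy of [T0, T1]. *)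
have [c cE] : divides 'X_ord0 (H@_U_(ord_max)).
  apply: (rel_prime_divides (b := 'X_ord_max) (@mpoly_factorial K 2) X0n).
    exact: variables_rel_prime.
  exists (- G@_U_(ord_max)); apply/eqP; rewrite mulrN -addr_eq0 addrC.
  by rewrite -Pm P_no_X2.
pose g0 := - G@_U_(i31); pose h0 := - H@_U_(i31).
pose g1 := G@_U_(ord0); pose h1 := H@_U_(ord0).
have p0E : p0 = 'X_ord0 * g0 + 'X_ord_max * h0 by rewrite Pm /g0 /h0 !mulrN opprD.
have p1E : p1 = 'X_ord0 * g1 + 'X_ord_max * h1 by rewrite Pm.
exists g0, h0, g1, h1, c; split=> //.
- by split; rewrite ?rpredN; [exact: Gc | exact: Hc | exact: Gc | exact: Hc].
- have k1 : (0 < k - 1 < k)%N by move: k_ge3; lia.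
  have [psiF1 _ _ _] := F_sequence_facts k1.
  apply: etrans (congr1 psi LE') _.
  rewrite (@conic_sylvester _ p0 p1 'X_ord0 'X_ord_max (lift_coef f0) (lift_coef f1) G H
    (sylvester_form g0 h0 g1 h1) c X0n) //.
  + apply: etrans (f_equal2 _ (congr1 psi (esym FE')) erefl) _.
    rewrite psiF1; have -> : ((k - 1).-1 = k - 2)%N by lia.
    by rewrite -!mulrA.
  + rewrite -PE'; apply: etrans (congr1 psi P_line) _.
    exact: conic_moving_line.
  rewrite /sylvester_form -/h1 -[H@_U_(i31)]opprK -/h0 p0E p1E; ring.
split.
- have kE : k = (k - 1 + 1)%N by move: k_ge3; lia.
  rewrite LE' kE; apply: rpredD; apply: dhomogM => //.
    by apply: lift_homog; move: f0h; rewrite kE.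
  by apply: lift_homog.
- have G0 := coef_at0_pos (i := 1) isT Gc; have H0 := coef_at0_pos (i := 1) isT Hc.
  rewrite LE' coef_at0D (coef_at0M _ G) (coef_at0M _ H).
  have zero (R : comNzRingType) (a b x x' : R) : x = 0 -> x' = 0 -> a * x + b * x' = 0.
    by move=> -> ->; ring.
  exact: zero G0 H0.
have k1 : (0 < k - 1 < k)%N by move: k_ge3; lia.
have [_ _ _ rF1] := F_sequence_facts k1.
rewrite LE'; apply: (rees_sylvester (t1 := 'X_ord_max) X0n); first by rewrite -PE'.
by rewrite -FE'.
Qed.

End Sequence.

(** * Minimality of a finite family *)

Section GeneratorList.
Variables (A : comNzRingType) (k : nat) (e p l : A) (F : nat -> A).
Hypothesis k_gt0 : (0 < k)%N.

Let gens := [:: e; p] ++ [seq F j | j <- iota 1 (k - 1)] ++ [:: l].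

Lemma size_gens : size gens = k.+2.
Proof. by rewrite /gens /= size_cat size_map size_iota /= addn1 subn1 prednK. Qed.

Lemma nth_gens_F j : (0 < j < k)%N -> gens`_j.+1 = F j.
Proof.
case/andP; case: j => // j _ jk; rewrite /gens /= nth_cat size_map size_iota.
have lt : (j < k - 1)%N by rewrite ltn_subRL add1n.
by rewrite lt (nth_map 0%N) ?size_iota // nth_iota // add1n.
Qed.

Lemma nth_gens_last : gens`_k.+1 = l.
Proof.
have -> : k.+1 = (k - 1).+2 by rewrite subn1 prednK.
by rewrite /gens /= nth_cat size_map size_iota ltnn subnn.
Qed.

Lemma sum_setT n (f : 'I_n -> A) : \sum_(i in [set: 'I_n]) f i = \sum_i f i.
Proof. by apply: eq_bigl => i; rewrite inE. Qed.

Lemma sum_gens (c : nat -> A) : \sum_(i < size gens) c i * gens`_i =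
  c 0%N * e + c 1%N * p + \sum_(1 <= j < k) c j.+1 * F j + c k.+1 * l.
Proof.
rewrite -(big_mkord predT (fun i => c i * gens`_i)) size_gens.
rewrite big_nat_recr // nth_gens_last; congr (_ + _).
rewrite big_ltn; last by [].
rewrite [in LHS]big_ltn; last by [].
apply: etrans (addrA _ _ _) _; congr (_ + _).
by rewrite big_add1; apply: eq_big_nat => j jk; rewrite nth_gens_F.
Qed.

(** A family generating [J] is minimal once no member is a combination of the
    others: dropping several members is worse than dropping one. *)
Lemma minimal_generators_list (J : A -> Prop) :
  (forall x, J x <-> exists b a f c,
     x = b * e + a * p + \sum_(1 <= j < k) f j * F j + c * l) ->
  (forall a f c, e <> 0 * e + a * p + \sum_(1 <= j < k) f j * F j + c * l) ->
  (forall b f c, p <> b * e + 0 * p + \sum_(1 <= j < k) f j * F j + c * l) ->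
  (forall j b a f c, (0 < j < k)%N -> f j = 0 ->
     F j <> b * e + a * p + \sum_(1 <= j < k) f j * F j + c * l) ->
  (forall b a f, l <> b * e + a * p + \sum_(1 <= j < k) f j * F j + 0 * l) ->
  minimal_generators J gens.
Proof.
move=> JE ne np nF nl.
have gen : generates J [set: 'I_(size gens)] (fun i => gens`_i).
  move=> x; rewrite JE; split=> [[b [a [f [c xE]]]]|[c xE]].
    pose cc i := if i is i'.+1 then if i' is i''.+1 then
      if i' == k then c else f i' else a else b.
    exists (fun i => cc i); rewrite xE sum_setT sum_gens /= eqxx.
    have -> : (if k is _.+1 then c else a) = c by case: (k) k_gt0.
    congr (_ + _ + _); apply: eq_big_nat => j /andP [j0 jk].
    by rewrite (ltn_eqF jk); case: j j0 {jk}.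
  pose cc i := if insub i is Some i' then c i' else 0.
  exists (cc 0%N), (cc 1%N), (fun j => cc j.+1), (cc k.+1).
  rewrite -sum_gens xE sum_setT; apply: eq_bigr => i _.
  by rewrite /cc valK.
split=> // D /properP [_ [i _ iD]] genD.
have : J gens`_i.
  apply/gen; exists (fun j => (j == i)%:R); rewrite sum_setT (bigD1 i) //=.
  by rewrite eqxx mul1r big1 ?addr0 // => j /negbTE ->; rewrite mul0r.
move=> /genD [c]; rewrite big_mkcond.
pose cc j := if insub j is Some j' then (if j' \in D then c j' else 0) else 0.
have -> : \sum_(j < size gens) (if j \in D then c j * gens`_j else 0)
   = \sum_(j < size gens) cc j * gens`_j.
  by apply: eq_bigr => j _; rewrite /cc valK; case: ifP; rewrite ?mul0r.
have cci : cc i = 0 by rewrite /cc valK (negbTE iD).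
rewrite sum_gens; move: (cc) cci (ltn_ord i) => {c} {}cc; move: (nat_of_ord i) => {iD} {}i.
rewrite size_gens; case: i => [|[|j]] cci; first by rewrite cci => _; exact: ne.
  by rewrite cci => _; exact: np.
rewrite !ltnS leq_eqVlt => /orP [/eqP jk|jk].
  by rewrite jk in cci *; rewrite nth_gens_last cci; exact: nl.
have jk' : (0 < j.+1 < k)%N by [].
by rewrite nth_gens_F //; apply: nF.
Qed.

End GeneratorList.

(** * Generation and minimality *)

Section Generators.
Variables (K : fieldType) (d k : nat) (u : 'I_3 -> {mpoly K[2]}).
Variables (p0 p1 w g0 h0 g1 h1 c : {mpoly K[2]}).
Variables (F : nat -> {mpoly {mpoly K[2]}[3]}) (L : {mpoly {mpoly K[2]}[3]}).
Variables (E : {mpoly K[3]}) (kap : K).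
Local Notation psi := (conic_map p0 p1).
Local Notation P := (moving_line p0 p1).
Local Notation q := (sylvester_form g0 h0 g1 h1).
Local Notation lam := (curve_eq w u).
Local Notation s := ('X%:P : {poly {poly {mpoly K[2]}}}).
Local Notation y := ('X : {poly {poly {mpoly K[2]}}}).
Local Notation "a %:S" := ((a%:P)%:P : {poly {poly {mpoly K[2]}}})
  (at level 2, format "a %:S").
Hypotheses (k_ge3 : (3 <= k)%N) (d_eq : d = (2 * k - 1)%N).
Hypothesis u_homog : forall i, u i \is d.-homog.
Hypotheses (p0_homog : p0 \is 2.-homog) (p1_homog : p1 \is 2.-homog).
Hypothesis p_coprime : rel_prime p0 p1.
Hypotheses (g0_homog : g0 \is 1.-homog) (h0_homog : h0 \is 1.-homog).
Hypotheses (g1_homog : g1 \is 1.-homog) (h1_homog : h1 \is 1.-homog).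
Hypothesis p0E : p0 = 'X_ord0 * g0 + 'X_ord_max * h0.
Hypothesis p1E : p1 = 'X_ord0 * g1 + 'X_ord_max * h1.
Hypotheses (w_homog : w \is (d - 2).-homog) (w_neq0 : w != 0).
Hypotheses (u0E : u ord0 = p0 * w) (u1E : u i31 = p1 * w).
Hypothesis w_coprime : rel_prime w (u ord_max).
Hypothesis kap_neq0 : kap != 0.
Hypotheses (P_rees : rees u P = 0) (P_at0 : coef_at0 P = 0).
Hypothesis F_facts : forall j, (0 < j < k)%N ->
  [/\ psi (F j) = kap%:MP%:S * (lam * s ^+ j.-1), F j \is j.-homog,
      coef_at0 (F j) = 0 & rees u (F j) = 0].
Hypothesis psiL :
  psi L = kap%:MP%:S * (lam * (s ^+ (k - 2) * (q%:S * s + c%:S * y))).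
Hypotheses (L_homog : L \is k.-homog) (L_at0 : coef_at0 L = 0) (L_rees : rees u L = 0).
Hypotheses (E_irr : irreducible_elt E) (E_homog : E \is d.-homog).
Hypothesis E_vanish : subst u E = 0.

(** The coefficient of [s ^+ l] is a combination of products of [l] factors [p0]
    or [p1], each of degree 2. *)
Lemma ord_conic_coef n (G : {mpoly {mpoly K[2]}[3]}) l x :
  (forall m, ord_ge n G@_m) -> ord_ge (n + 2 * l) ((psi G)`_x`_l).
Proof.
move=> Go; rewrite coef_conic; apply: ord_ge_sum => a _.
apply: ord_geM => //; apply: ord_ge_homog.
have le : (a <= l)%N by rewrite -ltnS.
have -> : (2 * l = 2 * a + 2 * (l - a))%N by rewrite -mulnDr subnKC.
by apply: dhomogM; apply: dhomogMn.
Qed.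

(** The weights: [s] has degree [-2] in [T], so that an element of positive
    degree in [T] has a quotient by [curve_eq] whose coefficients vanish to
    the order that makes them reachable. *)
Lemma ord_quotient G (e : nat -> nat -> {mpoly K[2]}) j l : coef_at0 G = 0 ->
  (forall j l, (l <= j)%N -> (psi G)`_(j - l)`_l =
     w * e j l - u ord_max * (if l is l'.+1 then e j l' else 0)) ->
  (l <= j)%N -> ord_ge (2 * (l - (k - 2))) (e j l).
Proof.
move=> G0 eE; elim: l => [|l IH] le; first by rewrite sub0n muln0; exact: ord_ge0.
have [le_l|lt_l] := leqP l.+1 (k - 2).
  by rewrite (eqP le_l) muln0; exact: ord_ge0.
apply: (ord_ge_cancel w_homog w_neq0).
have -> : (d - 2 + 2 * (l.+1 - (k - 2)) = 2 * l.+1 + 1)%N.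
  by rewrite d_eq; clear -lt_l k_ge3; lia.
have -> : w * e j l.+1 = (psi G)`_(j - l.+1)`_l.+1 + u ord_max * e j l.
  by rewrite eE // subrK.
apply: ord_geD.
  rewrite addnC; apply: ord_conic_coef => m m' nz.
  rewrite lt0n; apply: contra nz; rewrite mdeg_eq0 => /eqP ->.
  by rewrite -mcoeff_at0 G0 mcoeff0.
apply: (@ord_geW _ _ (d + 2 * (l - (k - 2)))).
  by rewrite d_eq; clear -lt_l k_ge3; lia.
by apply: ord_geM; [apply: ord_ge_homog | apply: IH; apply: ltnW].
Qed.

Lemma ideal_of_positive_degree G : rees u G = 0 -> coef_at0 G = 0 ->
  in_ideal p0 p1 k F L G.
Proof.
move=> Gk G0.
have [e [eE quo]] :=
  rees_kernel_quotient (@mpoly_factorial K 2) u0E u1E w_neq0 w_coprime Gk.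
apply: (@in_ideal_of_quotient _ (@mpoly_factorial K 2) p0 p1 p_coprime
  (pencil_neq0 p1_homog p_coprime) k F L lam kap%:MP q c _ _ _ psiL
  (fun n f => ord_ge n f) _ _ G (msize G) e _ quo).
- exact: ltnW.
- by rewrite mpoly_unitE msizeC kap_neq0.
- by move=> j jk; have [] := F_facts jk.
- move=> f fo; apply: (pencil_ord_ge2 p0_homog p1_homog p_coprime g0_homog
    h0_homog g1_homog h1_homog p0E p1E fo).
- by move=> n f n3 fo; apply: (pencil_ord_ge3 p0_homog p1_homog p_coprime n3 fo).
by move=> j l lt; apply: (ord_quotient G0 eE); apply: ltnW.
Qed.

Lemma E_prime : prime_elt E.
Proof. exact: mpoly_irreducible_prime. Qed.

Lemma d_gt0 : (0 < d)%N.
Proof. by rewrite d_eq; clear -k_ge3; lia. Qed.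

Lemma graded_subst_E : graded_subst u E = 0.
Proof.
apply/polyP => j; rewrite coef_graded_subst coef0.
have [->|nj] := eqVneq j d; first by rewrite pihomog_dE.
by rewrite (pihomog_ne0 _ E_homog) 1?eq_sym // /subst mmap0.
Qed.

Lemma rees_E : rees u (lift_coef E) = 0.
Proof. exact: graded_subst_E. Qed.

Definition combination b a (f : nat -> {mpoly {mpoly K[2]}[3]}) l :=
  b * lift_coef E + a * P + \sum_(1 <= j < k) f j * F j + l * L.

Lemma rees_combination b a f l : rees u (combination b a f l) = 0.
Proof.
rewrite /combination !reesD !reesM rees_E P_rees L_rees !mulr0 !add0r addr0.
rewrite rees_sum big_nat big1 // => j /F_facts [_ _ _ Fj].
by rewrite reesM Fj mulr0.
Qed.

(** The part of degree 0 in [T] is a multiple of [E]; the rest is reached by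
    the other generators. *)
Lemma kernel_combination G : rees u G = 0 -> exists b a f l, G = combination b a f l.
Proof.
move=> Gk; have G0 : graded_subst u (coef_at0 G) = 0.
  apply/polyP => j; rewrite coef_graded_subst coef0.
  by rewrite -(coef_rees_at0 (d := d)) // Gk coef0 pihomog0.
have [b bE] := prime_divides_curve_kernel p0_homog p1_homog p_coprime w_neq0 u0E u1E
  E_prime graded_subst_E G0.
have [||a [f [l GE]]] := @ideal_of_positive_degree (G - lift_coef (coef_at0 G)).
- by rewrite reesB Gk [rees u _]G0 subrr.
- apply/mpolyP => m; rewrite mcoeff_at0 mcoeffB mcoeff_lift mcoeff_at0 mcoeff0.
  by rewrite mcoeffB mcoeffC eqxx mulr1 subrr.
exists (lift_coef b), a, f, l; rewrite -[G](subrK (lift_coef (coef_at0 G))) GE.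
have perm (R : comNzRingType) (x1 x2 x3 x4 x5 : R) :
  x1 + x2 + x3 + x4 * x5 = x5 * x4 + x1 + x2 + x3 by ring.
by rewrite bE lift_coefM; exact: perm.
Qed.

(** Setting [T = 0] kills all other generators. *)
Lemma E_not_redundant a f l : lift_coef E <> combination 0 a f l.
Proof.
move=> /(congr1 (@coef_at0 K 3)); rewrite coef_at0K /combination mul0r add0r.
rewrite !coef_at0D !coef_at0M P_at0 L_at0 !mulr0 add0r addr0 => E0.
have [/eqP nz _ _] := E_irr; apply: nz; rewrite E0 big_nat.
elim/big_ind: _ => [|x x' x0 x'0|j /F_facts [_ _ Fj _]].
- by apply/mpolyP => m; rewrite mcoeff_at0 !mcoeff0.
- by rewrite coef_at0D x0 x'0 addr0.
- by rewrite coef_at0M Fj mulr0.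
Qed.

Lemma kap_S_neq0 : kap%:MP != 0 :> {mpoly K[2]}.
Proof. by rewrite mpolyC_eq0. Qed.

Lemma F_psi j : (0 < j < k)%N -> psi (F j) = kap%:MP%:S * (lam * s ^+ j.-1).
Proof. by move=> /F_facts []. Qed.

Lemma F_homog j : (0 < j < k)%N -> F j \is j.-homog.
Proof. by move=> /F_facts []. Qed.

Lemma coef_of_combination n b a f l X Z :
  (0 < n <= k)%N -> (n < k)%N \/ l = 0 -> X \is n.-homog ->
  psi X = kap%:MP%:S * (lam * Z) -> X = combination b a f l ->
  Z`_0`_n.-1 = \sum_(1 <= j < k)
     if (j <= n)%N then (psi (pihomog mdeg (n - j) (f j)))`_0`_(n - j) else 0.
Proof.
move=> /andP [n0 nk]; apply: (@coef_combination _ p0 p1 k d F L (lift_coef E) lam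
  kap%:MP kap_S_neq0 (curve_eq_neq0 u w_neq0) F_psi F_homog L_homog _ n b a f l X Z n0).
  exact: lift_homog.
by rewrite d_eq; clear -nk k_ge3; lia.
Qed.

Lemma moving_line_neq0 : P != 0.
Proof.
apply/eqP => /(congr1 (mcoeff U_(i31))); rewrite mcoeff0 mcoeffB !mcoeffZ !mcoeffXU.
rewrite mulr0 mulr1 sub0r => /eqP; rewrite oppr_eq0.
by rewrite (negbTE (pencil_neq0 p1_homog p_coprime)).
Qed.

(** In degree 1 in [X] only [F 1] is available, and its image does not vanish. *)
Lemma P_not_redundant b f l : P <> combination b 0 f l.
Proof.
move=> PE.
have k1 : (0 < 1 < k)%N by clear -k_ge3; lia.
have d1 : (1 < d)%N by rewrite d_eq; clear -k_ge3; lia.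
have PF : P = F 1 * ((f 1)@_0)%:MP.
  rewrite -pihomog0E -[LHS](pihomog_dE (moving_line_homog p0 p1)) [in LHS]PE.
  apply: etrans (@pihomog_combination _ p0 p1 k d F L (lift_coef E) F_homog L_homog
    (lift_homog E_homog) 1 b 0 f l isT d1 (or_introl (ltnW k_ge3))) _.
  rewrite pihomog0 mulr0 add0r big_ltn //= subnn big_nat big1 ?addr0 //.
  by move=> j /andP [j1 _]; rewrite leqNgt j1.
have psiF1 : psi (F 1) != 0.
  rewrite (F_psi k1) expr0 mulf_neq0 ?polyC_eq0 ?kap_S_neq0 //.
  by rewrite mulf_neq0 ?oner_eq0 // curve_eq_neq0.
have x0 : (f 1)@_0 = 0.
  apply: (conic_scale_eq0 psiF1); rewrite -PF; exact: conic_moving_line.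
by have /eqP := moving_line_neq0; apply; rewrite PF x0 mpolyC0 mulr0.
Qed.

(** The coefficient of [s ^+ j.-1] is [1] on the left, while the [F i] with
    [i < j] only contribute polynomials without constant term. *)
Lemma F_not_redundant j b a f l : (0 < j < k)%N -> f j = 0 -> F j <> combination b a f l.
Proof.
move=> jk fj FE; have /andP [j0 ltjk] := jk.
have := coef_of_combination _ (or_introl ltjk) (F_homog jk) (F_psi jk) FE.
rewrite j0 (ltnW ltjk) => /(_ isT).
rewrite -rmorphXn coefC eqxx coefXn eqxx => one.
have : ord_ge 1 (1 : {mpoly K[2]}).
  rewrite (one : 1 = _) big_nat; apply: ord_ge_sum => i /andP [i0 ik].
  case: ifP => le; last exact: ord_ge_zero.
  have [->|ne] := eqVneq i j.
    by rewrite fj pihomog0 conic_map0 !coef0; exact: ord_ge_zero.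
  apply: (@ord_geW _ _ (0 + 2 * (j - i))); first by clear -le ne; lia.
  by apply: ord_conic_coef => m; exact: ord_ge0.
by move=> /(_ 0%MM); rewrite mcoeff1 eqxx oner_eq0 mdeg0 => /(_ isT).
Qed.

(** The coefficient of [s ^+ k.-1] is the Sylvester form on the left; in degree 2 in
    [T] only [F k.-1] contributes to it, with a combination of [p0] and [p1]. *)
Lemma L_not_redundant b a f : L <> combination b a f 0.
Proof.
move=> LE.
have k0 : (0 < k <= k)%N by rewrite leqnn andbT; apply: leq_trans k_ge3.
have := coef_of_combination k0 (or_intror erefl) L_homog psiL LE.
have -> : (s ^+ (k - 2) * (q%:S * s + c%:S * y))`_0`_k.-1 = q.
  rewrite -rmorphXn coefCM coefD coefCM coefC eqxx coefCM coefX mulr0 addr0.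
  rewrite coefXnM coefCM coefX; have -> : (k.-1 < k - 2)%N = false by clear -k_ge3; lia.
  by have -> : (k.-1 - (k - 2) = 1)%N by [clear -k_ge3; lia]; rewrite eqxx mulr1.
have k1 : (k.-1 <= k)%N by exact: leq_pred.
have kE : k = k.-1.+1 by rewrite prednK //; case/andP: k0.
have split_last (T : nmodType) (G : nat -> T) :
    \sum_(1 <= j < k) G j = \sum_(1 <= j < k.-1) G j + G k.-1.
  by rewrite [in LHS]kE big_nat_recr //; clear -k_ge3; lia.
rewrite split_last k1; have -> : (k - k.-1 = 1)%N by clear -k_ge3; lia.
(* The [F j] with [j < k - 1] only contribute in degree at least 4 in [T]. *)
set R := \sum_(1 <= j < k.-1) _.
have R0 : pihomog mdeg 2 R = 0.
  suff /ord_geP : ord_ge 3 R by apply.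
  rewrite /R big_nat; apply: ord_ge_sum => j /andP [j0 jk].
  case: ifP => _; last exact: ord_ge_zero.
  apply: (@ord_geW _ _ (0 + 2 * (k - j))); first by clear -jk; lia.
  by apply: ord_conic_coef => m; exact: ord_ge0.
rewrite coef_conic big_ord_recl big_ord1 /= expr0 !expr1 mul1r mulr1.
set x := _@_(mon3 0 _ 0); set z := _@_(mon3 _ _ 0) => qE.
have scal (t p : {mpoly K[2]}) : p \is 2.-homog -> pihomog mdeg 2 (t * p) = t@_0 *: p.
  move=> ph; rewrite mulrC; apply: etrans (pihomogMl 0 t ph) _.
  by rewrite pihomog0E mulrC mul_mpolyC.
apply: (sylvester_form_notin p0_homog p1_homog p_coprime h0_homog p0E p1E
  (al := z@_0) (be := x@_0)).
rewrite -(pihomog_dE (sylvester_form_homog g0_homog h0_homog g1_homog h1_homog)) qE.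
by rewrite !pihomogD R0 add0r !scal // addrC.
Qed.

Theorem generators_minimal : minimal_generators (fun G => rees u G = 0)
  ([:: lift_coef E; P] ++ [seq F j | j <- iota 1 (k - 1)] ++ [:: L]).
Proof.
apply: minimal_generators_list; first exact: leq_trans k_ge3.
- move=> G; split; first exact: kernel_combination.
  by move=> [b [a [f [l ->]]]]; exact: rees_combination.
- exact: E_not_redundant.
- exact: P_not_redundant.
- exact: F_not_redundant.
- exact: L_not_redundant.
Qed.

End Generators.

(** * The moving curve ideal *)

Theorem theorem3p4 (K : closedFieldType) (d k mu : nat)
    (u : 'I_3 -> KT K) (P Q : KTX K) (E : KX K)
    (F : nat -> KTX K) (L : KTX K)
    (k_ge2 : (2 <= k)%N) (d_eq : d = (2 * k - 1)%N)
    (u_homog : forall i, u i \is d.-homog)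
    (u_coprime : no_common_factor u)
    (PQ_basis : mu_basis u d mu P Q)
    (mu_eq2 : mu = 2%N)
    (u_proper : proper_param u)
    (E_irr : mpoly_irreducible E)
    (E_homog : E \is d.-homog)
    (E_curve : defines_curve u E)
    (vsing : very_singular u E mu (point001 K))
    (F_def : F_sequence P Q k F)
    (L_def : last_F P (F (k - 1)%N) k L) :
  let gens := [:: inX E; P] ++ [seq F j | j <- iota 1 (k - 1)] ++ [:: L] in
  [/\ size gens = k.+2, k.+2 = ((d + 5) %/ 2)%N
    & minimal_generators (rees_kernel u) gens].
Proof.
move=> gens.
have k_gt0 : (0 < k)%N by exact: leq_trans k_ge2.
split; first exact: (size_gens (inX E) P L F k_gt0).
  by rewrite d_eq; clear -k_ge2; lia.
rewrite /gens {gens}.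
move: mu_eq2 PQ_basis vsing => -> basis [_ E_mult].
have k3 := k_ge3 k_ge2 d_eq basis.
have [E0 _ _] := E_irr.
have noX2 := P_no_X2 k_ge2 d_eq u_homog u_coprime basis u_proper E0 E_homog E_curve E_mult.
have PE := P_moving_line k_ge2 d_eq u_homog u_coprime basis u_proper E0 E_homog E_curve E_mult.
have cop := p_coprime k_ge2 d_eq u_homog u_coprime basis u_proper E0 E_homog E_curve E_mult.
have [w [wh w0 u0E u1E wcop]] :=
  factor_w k_ge2 d_eq u_homog u_coprime basis u_proper E0 E_homog E_curve E_mult.
have [kap kap0 psiQ] := conic_Q k_ge2 d_eq u_homog u_coprime basis u_proper E0 E_homog
  E_curve E_mult wh w0 u0E u1E wcop.
have p1h := p1_homog basis; have p0h := p0_homog basis.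
have p00 := pencil_neq0 p1h cop.
have Ff := F_sequence_facts p00 PE k3 d_eq (rees_P basis) (rees_Q basis) (Q_homog basis)
  (Q_coef_homog basis) psiQ F_def.
have [g0 [h0 [g1 [h1 [c [[g0h h0h g1h h1h] p0E p1E psiL [Lh L0 Lk]]]]]]] :=
  last_F_facts p00 PE k3 d_eq (rees_P basis) (rees_Q basis) (Q_homog basis)
  (Q_coef_homog basis) psiQ F_def L_def noX2.
have Pat0 : coef_at0 P = 0 by exact: (coef_at0_pos (i := 2) isT (P_coef_homog basis)).
have Pk := rees_P basis.
have d0 : (0 < d)%N by rewrite d_eq; clear -k_ge2; lia.
have Ev := curve_equation_vanish d0 u_homog E_homog E_curve.
apply: (eq_ind_r (fun X : KTX K =>
  minimal_generators (rees_kernel u) ([:: inX E; X] ++ _)) _ PE).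
rewrite {1}PE in Pat0; rewrite {1}PE in Pk.
exact: (generators_minimal k3 d_eq u_homog p0h p1h cop g0h h0h g1h h1h p0E p1E wh w0 u0E u1E
  wcop kap0 Pk Pat0 Ff psiL Lh L0 Lk E_irr E_homog Ev).
Qed.
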